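(* Let $\psi^{(i)}_{j,k}$ be the periodized wavelets on $\mathbb{T}=\mathbb{R}^d/\mathbb{Z}^d$ associated with an orthonormal $1$-smooth wavelet basis of $\mathbb{R}^d$. Let $(\chi^{i}_{j,k})$ be a sequence of I.I.D. random variables with common law $\chi$ with exponential decay of order $\gamma$, i.e. there are constants $C_0,b>0$ and $\gamma\in(0,2]$ such that $$\mathbb{P}(|\chi|\ge x)\le C_0e^{-bx^\gamma}\quad\text{for all } x>0,$$ and let $f\in C^\alpha(\mathbb{T})$ where $\alpha\in(0,1)$. Then the wavelet randomization $X_f$ of $f$ satisfies that almost surely, there exists $C>0$ such that $$|X_f(x)-X_f(y)|\le C\,|x-y|^\alpha\,\bigl|\log(|x-y|)\bigr|^{1/\gamma}\quad\text{for all } x,y\in\mathbb{T},\ x\ne y.$$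
   Context: An orthonormal $r$-smooth ($r\ge 0$) wavelet basis on $\mathbb{R}^d$ is a collection of functions $\varphi$ and $\Psi^{(i)}$, $i\in\{1,\dots,2^d-1\}$, such that: $\varphi$, the $\Psi^{(i)}$ and all their partial derivatives up to order $r$ have fast decay (faster than any negative power of $1+|x|$); and the functions $\varphi(\cdot-k)$, $k\in\mathbb{Z}^d$, together with $2^{dj/2}\Psi^{(i)}(2^j\cdot-k)$, $j\in\mathbb{N}$, $k\in\mathbb{Z}^d$, $i\in\{1,\dots,2^d-1\}$, form an orthonormal basis of $L^2(\mathbb{R}^d)$. The periodized wavelets on $\mathbb{T}$ are $\psi^{(i)}_{j,k}(x)=\sum_{l\in\mathbb{Z}^d}\Psi^{(i)}(2^j(x-l)-k)$, for $i\in\{1,\dots,2^d-1\}$, $j\in\mathbb{N}$, $k\in\mathbb{Z}^d$ with $2^{-j}k\in[0,1)^d$. No $L^2$ normalization is used: the wavelet coefficients of $f$ are $c^i_{j,k}=2^{dj}\int_{\mathbb{T}}f\,\psi^{(i)}_{j,k}$. The wavelet randomization of $f$ is $X_f=\sum_{i,j,k}c^i_{j,k}\chi^i_{j,k}\psi^{(i)}_{j,k}$. For $\alpha\in(0,1)$, $f\in C^\alpha(\mathbb{T})$ means that $f$ is bounded on $\mathbb{T}$ and there is $C>0$ with $|f(x)-f(y)|\le C|x-y|^\alpha$ for all $x,y$. On $\mathbb{T}$, $|x-y|$ denotes the quotient distance induced by the max norm of $\mathbb{R}^d$ (so $|x-y|\le 1/2$). *)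

(* Defs.v *)
From HB Require Import structures.
From mathcomp Require Import all_boot all_order all_algebra finmap.
From mathcomp Require Import all_classical all_reals all_analysis.
From mathcomp.analysis Require summability.
Import Order.TTheory GRing.Theory Num.Theory.
Import numFieldNormedType.Exports.

Set Implicit Arguments.
Unset Strict Implicit.
Unset Printing Implicit Defensive.

Local Open Scope classical_set_scope.
Local Open Scope ring_scope.

Section row_vector_measurable.
Context d (T : sigmaRingType d).
Variable n : nat.

(* The product sigma-algebra, as for n.-tuple T in the library. *)
Let coors : 'I_n -> 'rV[T]_n -> T := fun i x => x ord0 i.

Let row_set0 : g_sigma_preimage coors set0.
Proof. exact: sigma_algebra0. Qed.

Let row_setC A : g_sigma_preimage coors A -> g_sigma_preimage coors (~` A).
Proof. exact: sigma_algebraC. Qed.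

Let row_bigcup (F : (set 'rV[T]_n)^nat) :
  (forall i, g_sigma_preimage coors (F i)) ->
  g_sigma_preimage coors (\bigcup_i (F i)).
Proof. exact: sigma_algebra_bigcup. Qed.

HB.instance Definition _ := @isMeasurable.Build (measure_tuple_display d)
  'rV[T]_n (g_sigma_preimage coors) row_set0 row_setC row_bigcup.

End row_vector_measurable.

Lemma measurable_coord d (T : sigmaRingType d) n (i : 'I_n) :
  measurable_fun [set: 'rV[T]_n] (fun x => x ord0 i).
Proof.
move=> _ Y mY; rewrite setTI; apply: sub_sigma_algebra => /=.
rewrite -bigcup_seq/=; exists i => /=; first by rewrite mem_index_enum.
by exists Y => //; rewrite setTI.
Qed.

Lemma measurable_fun_rowP d1 d2 (T1 : measurableType d1)
    (T2 : measurableType d2) n (f : T1 -> 'rV[T2]_n) :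
  (forall i, measurable_fun [set: T1] (fun x => f x ord0 i)) ->
  measurable_fun [set: T1] f.
Proof.
move=> mf _ A mA; rewrite setTI.
pose G := [set B : set 'rV[T2]_n | measurable (f @^-1` B)].
suff : measurable `<=` G by exact.
apply: smallest_sub.
  rewrite /G; split=> /= [|B GB|F GF].
  - by rewrite preimage_set0.
  - by rewrite setTD preimage_setC; exact: measurableC.
  - by rewrite preimage_bigcup; exact: bigcup_measurable.
move=> B; rewrite -bigcup_seq => -[i _ [C mC <-]].
by have := mf i measurableT C mC; rewrite /G/= !setTI.
Qed.

Section lebesgue_rV.
Context {R : realType}.

Definition row_cons n (p : R * 'rV[R]_n) : 'rV[R]_n.+1 :=
  \row_i oapp (p.2 ord0) p.1 (unlift ord0 i).

Lemma row_cons0 n (p : R * 'rV[R]_n) : row_cons p ord0 ord0 = p.1.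
Proof. by rewrite mxE unlift_none. Qed.

Lemma row_consS n (p : R * 'rV[R]_n) i :
  row_cons p ord0 (lift ord0 i) = p.2 ord0 i.
Proof. by rewrite mxE liftK. Qed.

Lemma measurable_row_cons n : measurable_fun setT (@row_cons n).
Proof.
apply: measurable_fun_rowP => i; have [j ->|->] := unliftP ord0 i; last first.
  rewrite [X in measurable_fun _ X](_ : _ = fst) //.
  by apply/funext => p; exact: row_cons0.
rewrite [X in measurable_fun _ X](_ : _ = (fun x : 'rV[R]_n => x ord0 j) \o snd).
  by apply: measurableT_comp => //; exact: measurable_coord.
by apply/funext => p; exact: row_consS.
Qed.

HB.instance Definition _ n :=
  isMeasurableFun.Build _ _ _ _ (@row_cons n) (@measurable_row_cons n).

Lemma measurable_row_behead n :
  measurable_fun setT (fun x : 'rV[R]_n.+1 => \row_i x ord0 (lift ord0 i) : 'rV[R]_n).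
Proof.
apply: measurable_fun_rowP => i.
rewrite [X in measurable_fun _ X](_ : _ = fun x : 'rV[R]_n.+1 => x ord0 (lift ord0 i)).
  exact: measurable_coord.
by apply/funext => x; rewrite mxE.
Qed.

Section lebesgue_rV_step.
Variables (n : nat) (mu : {sigma_finite_measure set 'rV[R]_n -> \bar R}).

Definition lebesgue_rV_step : set 'rV[R]_n.+1 -> \bar R :=
  pushforward (lebesgue_measure \x mu)%E (@row_cons n).

Let lebesgue_rV_step0 : lebesgue_rV_step set0 = 0%E.
Proof. by rewrite /lebesgue_rV_step /pushforward preimage_set0 measure0. Qed.

Let lebesgue_rV_step_ge0 A : (0 <= lebesgue_rV_step A)%E.
Proof. by rewrite /lebesgue_rV_step /pushforward measure_ge0. Qed.

Let lebesgue_rV_step_sigma_additive : semi_sigma_additive lebesgue_rV_step.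
Proof.
exact: (@measure_semi_sigma_additive _ _ _
  (measure_function_pushforward__canonical__measure_function_Measure
    (lebesgue_measure \x mu)%E (@measurable_row_cons n))).
Qed.

HB.instance Definition _ := isMeasure.Build _ _ _ lebesgue_rV_step
  lebesgue_rV_step0 lebesgue_rV_step_ge0 lebesgue_rV_step_sigma_additive.

Let lebesgue_rV_step_sigma_finite : sigma_finite setT lebesgue_rV_step.
Proof.
have /sigma_finiteP[F [TF ndF Foo]] := sigma_finiteT (@lebesgue_measure R).
have /sigma_finiteP[G [TG ndG Goo]] := sigma_finiteT mu.
pose g (x : 'rV[R]_n.+1) := (x ord0 ord0, \row_i x ord0 (lift ord0 i)).
have mg : measurable_fun setT g.
  by apply/measurable_fun_pair; [exact: measurable_coord|
                                 exact: measurable_row_behead].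
have gK : cancel (@row_cons n) g.
  move=> p; rewrite /g row_cons0 [p in RHS]surjective_pairing; congr pair.
  by apply/rowP => i; rewrite mxE row_consS.
exists (fun k => g @^-1` (F k `*` G k)).
  apply/seteqP; split=> // x _.
  have [i _ Fi] : (\bigcup_k F k) (g x).1 by rewrite -TF.
  have [j _ Gj] : (\bigcup_k G k) (g x).2 by rewrite -TG.
  exists (maxn i j) => //; split.
  - by move: Fi; exact/subsetPset/ndF/leq_maxl.
  - by move: Gj; exact/subsetPset/ndG/leq_maxr.
move=> k; have [mF Foo'] := Foo k; have [mG Goo'] := Goo k; split.
  rewrite -[X in measurable X]setTI; apply: mg => //; exact: measurableX.
rewrite /lebesgue_rV_step /pushforward -comp_preimage.
rewrite (_ : g \o _ = id); last by rewrite funeqE => p /=; rewrite gK.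
by rewrite preimage_id product_measure1E// lte_mul_pinfty// ge0_fin_numE.
Qed.

HB.instance Definition _ := Measure_isSigmaFinite.Build _ _ _
  lebesgue_rV_step lebesgue_rV_step_sigma_finite.

End lebesgue_rV_step.

Fixpoint lebesgue_rV n : {sigma_finite_measure set 'rV[R]_n -> \bar R} :=
  match n with
  | 0 => \d_(0 : 'rV[R]_0)
  | n.+1 => lebesgue_rV_step (lebesgue_rV n)
  end.

End lebesgue_rV.

Lemma lebesgue_rV_box {R : realType} n (A : 'I_n -> set R) :
  (forall i, measurable (A i)) ->
  lebesgue_rV n [set x : 'rV[R]_n | forall i, A i (x ord0 i)] =
  (\prod_(i < n) lebesgue_measure (A i))%E.
Proof.
elim: n A => [|n IH] A mA.
  rewrite big_ord0 /= (_ : [set _ | _] = setT) ?diracT//.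
  by apply/seteqP; split=> // x _ /= [].
rewrite big_ord_recl -IH//= /lebesgue_rV_step /pushforward.
rewrite -product_measure1E; last 2 first.
  exact: mA.
  rewrite (_ : [set _ | _] = \bigcap_(i in [set: 'I_n])
      ([set: 'rV[R]_n] `&` (fun x => x ord0 i) @^-1` (A (lift ord0 i)))).
    apply: fin_bigcap_measurable => // i _; exact: measurable_coord.
  by apply/seteqP; split=> [x h i _|x h i]; [split=> //; exact: h|have [] := h i I].
congr (product_measure1 _ _ _); apply/seteqP; split=> p /=.
  move=> h; split; first by rewrite -row_cons0; exact: h.
  by move=> i; rewrite -row_consS; exact: h.
move=> [h0 hS] i; have [j ->|->] := unliftP ord0 i; last by rewrite row_cons0.
by rewrite row_consS; exact: hS.
Qed.

Definition intv {R : realType} {d} (k : 'rV[int]_d) : 'rV[R]_d :=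
  map_mx intr k.

Definition fast_decay {R : realType} {d} (g : 'rV[R]_d -> R) :=
  forall N : nat, exists C : R, forall x, `|g x| <= C * (1 + `|x|) ^- N.

Fixpoint smooth_fast_decay {R : realType} {d} (r : nat) (g : 'rV[R]_d -> R) :=
  fast_decay g /\
  match r with
  | 0 => True
  | r'.+1 => forall s : 'I_d,
      (forall x, derivable g x (delta_mx ord0 s)) /\
      smooth_fast_decay r' ('D_(delta_mx ord0 s) g)
  end.

(* Hilbert basis: completeness is density of the linear span in L^2. *)
Definition orthonormal_basis_L2 {R : realType} {dd} {T : measurableType dd}
    (mu : {measure set T -> \bar R}) (I : choiceType) (e : I -> T -> R) :=
  [/\ forall a, e a \in Lfun mu 2%:E,
      forall a b, \int[mu]_x (e a x * e b x) = (a == b)%:R &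
      forall g, g \in Lfun mu 2%:E -> forall eps : R, 0 < eps ->
        exists (s : {fset I}) (c : I -> R),
          ('N[mu]_2%:E[EFin \o (fun x => (g x - \sum_(a <- s) c a * e a x)%R)]
             < eps%:E)%E].

Section wavelets.
Context {R : realType} {d : nat}.
Variables (phi : 'rV[R]_d -> R) (Psi : 'I_(2 ^ d).-1 -> 'rV[R]_d -> R).

Definition wavelet_family
    (a : 'rV[int]_d + 'I_(2 ^ d).-1 * nat * 'rV[int]_d) (x : 'rV[R]_d) : R :=
  match a with
  | inl k => phi (x - intv k)
  | inr (i, j, k) =>
      2 `^ ((d * j)%:R / 2) * Psi i (2 ^+ j *: x - intv k)
  end.

Definition orthonormal_wavelet_basis (r : nat) :=
  [/\ smooth_fast_decay r phi,
      forall i, smooth_fast_decay r (Psi i) &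
      orthonormal_basis_L2 (lebesgue_rV d) wavelet_family].

End wavelets.

(* Functions on T = R^d / Z^d are Z^d-periodic functions on R^d, and points of
   T are represented by points of R^d. *)

Section torus.
Context {R : realType} {d : nat}.
Implicit Types (x y : 'rV[R]_d) (f : 'rV[R]_d -> R).

Definition torus_eq x y := exists l : 'rV[int]_d, x = y + intv l.

Definition Zd_periodic f := forall x y, torus_eq x y -> f x = f y.

(* `|_| is the max norm on 'rV[R]_d. *)
Definition torus_dist x y : R :=
  inf [set `|x - y - intv l| | l in [set: 'rV[int]_d]].

Definition unit_cube : set 'rV[R]_d :=
  [set x | forall s, 0 <= x ord0 s < 1].

Definition holder_torus (alpha : R) f :=
  [/\ Zd_periodic f,
      exists M : R, forall x, `|f x| <= M &
      exists2 C : R, 0 < C &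
        forall x y, `|f x - f y| <= C * torus_dist x y `^ alpha].

End torus.

(* The triples (i, j, k) with 2^-j k in [0, 1)^d. *)
Definition wavelet_index (d : nat) : choiceType :=
  {n : 'I_(2 ^ d).-1 * nat * 'rV[int]_d |
    [forall s, 0 <= n.2 ord0 s < 2 ^+ n.1.2]}.

Section randomization.
Context {R : realType} {d : nat}.
Variable Psi : 'I_(2 ^ d).-1 -> 'rV[R]_d -> R.
Implicit Types (n : wavelet_index d) (f : 'rV[R]_d -> R).

(* summability.sum, here and below, is the limit of partial sums along the net of finite subsets. *)
Definition periodized_wavelet n (x : 'rV[R]_d) : R :=
  let: (i, j, k) := val n in
  summability.sum
    (fun l : 'rV[int]_d => Psi i (2 ^+ j *: (x - intv l) - intv k)).

Definition wavelet_coef f n : R :=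
  2 ^+ (d * (val n).1.2) *
  \int[lebesgue_rV d]_(x in unit_cube) (f x * periodized_wavelet n x).

Definition randomization_term f (chi : wavelet_index d -> R) x n : R :=
  wavelet_coef f n * chi n * periodized_wavelet n x.

Definition wavelet_randomization f (chi : wavelet_index d -> R) x : R :=
  summability.sum (randomization_term f chi x).

End randomization.

Section iid.
Context {dO} {Omega : measurableType dO} {R : realType}.
Variable P : probability Omega R.

Definition mutually_independent (I : choiceType) (X : I -> {RV P >-> R}) :=
  forall (J : {fset I}) (A : I -> set R), (forall n, measurable (A n)) ->
    P (\bigcap_(n in [set` J]) (X n @^-1` A n)) =
    (\prod_(n <- J) P (X n @^-1` A n))%E.

Definition iid (I : choiceType) (X : I -> {RV P >-> R})
    (law : probability R R) :=
  mutually_independent X /\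
  forall n A, measurable A -> distribution P (X n) A = law A.

End iid.

Definition exponential_decay {R : realType} (law : probability R R)
    (gamma : R) :=
  exists C0 b : R, [/\ 0 < C0, 0 < b &
    forall x : R, 0 < x ->
      (law [set y : R | (x <= `|y|)%R] <= (C0 * expR (- b * x `^ gamma))%:E)%E].

(* Main.v *)
Require Import Defs.
From HB Require Import structures.
From mathcomp Require Import all_boot all_order all_algebra finmap.
From mathcomp Require Import all_classical all_reals all_analysis.
From mathcomp.analysis Require summability.
From mathcomp.analysis Require Import measurable_realfun.
From mathcomp Require Import ring lra zify.
Import Order.TTheory GRing.Theory Num.Theory.
Import numFieldNormedType.Exports.

Set Implicit Arguments.
Unset Strict Implicit.
Unset Printing Implicit Defensive.

Local Open Scope classical_set_scope.
Local Open Scope ring_scope.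

(** The vanishing moment of the wavelets turns the Hoelder bound on [f] into
    [|c_(j,k)| <= C 2^(- alpha j)].  By the tail bound and Borel-Cantelli,
    almost surely [|chi_(j,k)| <= B (1 + j)^(1/gamma)] for all indices.  Since
    the wavelets and their gradients decay fast, the scale [j] contributes at
    most a constant times
    [2^(- alpha j) (1 + j)^(1/gamma) min(1, 2^j |x - y|)] to
    [|X_f x - X_f y|]; the sum over [j] is dominated by the scales with
    [2^j] close to [1 / |x - y|].  The vanishing moment itself is obtained from
    orthogonality to finer and finer rescaled copies of the wavelet around a
    dyadic point where it does not vanish. *)

(** * Unconditional sums *)

(** Every estimate bounds absolute values, one level [j] at a time. Within a level, the sum over
    positions costs only a constant: the pairs (position [k], period [l]) correspond injectively to
    the lattice points [k + 2 ^ j l], so a single lattice sum of [(1 + |.|) ^ (- 2 d)] controls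
    periodization and positions together. The power [1 / gamma] comes from counting. Level [j]
    carries at most [(2 ^ d - 1) 2 ^ (d j)] coefficients, and a suitable multiple of
    [(1 + j) ^ (1 / gamma)] is exceeded by each with probability at most
    [C0 2 ^ (- (d + 1) (j + 1))], which is summable against this count. At the critical scale
    [2 ^ j ~ 1 / |x - y|], [1 + j] is of order [|log |x - y||]. Both bounds on [alpha] matter there:
    [alpha > 0] makes the contributions decay at scales finer than the critical one, and [alpha < 1]
    makes them decay towards the coarser ones. *)

Section unconditional_sums.
Context {R : realType} {I : choiceType}.
Implicit Types (u v : I -> R) (J : {fset I}) (M : R).

(** An l^1 bound stated on finite sums only: it involves no limit, passes to subfamilies along
    injections, and gives both convergence and a bound on the sum. *)
Definition abs_sums_le u M := forall J, \sum_(i <- J) `|u i| <= M.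

Lemma partial_sumE u J : summability.partial_sum u J = \sum_(i <- J) u i.
Proof. by rewrite big_seq_fsetE. Qed.

Lemma abs_sums_le_comp (I' : choiceType) (h : I' -> I) u M : injective h ->
  abs_sums_le u M -> forall J : {fset I'}, \sum_(i <- J) `|u (h i)| <= M.
Proof.
move=> hI uM J; apply: le_trans (uM [fset h i | i in J]%fset).
by rewrite big_imfset//= => i j _ _ /hI.
Qed.

Lemma summable_abs_sums u M : abs_sums_le u M -> summability.summable u.
Proof.
move=> uM; exists M; split; first exact: num_real.
move=> M' MM'; exists fset0 => // J _; rewrite partial_sumE.
exact: le_trans (uM J) (ltW MM').
Qed.

(** The net is Cauchy: once [J0] has an absolute sum within [e] of the supremum, any larger finite
    set adds less than [e]. *)
Lemma cvg_partial_sum u M : abs_sums_le u M ->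
  summability.partial_sum u @ summability.totally --> summability.sum u.
Proof.
move=> uM; have F := @summability.totally_filter I.
apply: cauchy_cvg; apply: cauchy_exP => e e0.
pose S := [set \sum_(i <- J) `|u i| | J in [set: {fset I}]].
have S0 : S !=set0 by exists (\sum_(i <- fset0) `|u i|), fset0.
have hS : has_sup S by split => //; exists M => _ [J _ <-]; exact: uM.
have [_ [J0 _ <-] J0S] := sup_adherent e0 hS.
have tailJ A : (J0 `<=` A)%fset ->
    `|summability.partial_sum u A - summability.partial_sum u J0| < e.
  move=> J0A; rewrite !partial_sumE (big_fsetID _ (mem J0))/=.
  have -> : [fset x | x in A & x \in J0]%fset = J0.
    by apply/fsetP => x; rewrite !inE andbC; case: (boolP (x \in J0)) => //= /(fsubsetP J0A).
  rewrite addrAC subrr add0r (le_lt_trans (ler_norm_sum _ _ _))//.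
  have : \sum_(i <- A) `|u i| <= sup S by apply: ub_le_sup; [exact: hS.2|exists A].
  rewrite (big_fsetID _ (mem J0))/=.
  have -> : [fset x | x in A & x \in J0]%fset = J0.
    by apply/fsetP => x; rewrite !inE andbC; case: (boolP (x \in J0)) => //= /(fsubsetP J0A).
  by move: J0S; lra.
exists (summability.partial_sum u J0); exists J0 => //= A /tailJ.
by rewrite /ball/= distrC.
Qed.

Lemma cvg_partial_sum_eq u l :
  summability.partial_sum u @ summability.totally --> l -> summability.sum u = l.
Proof.
move=> ul; apply: (cvg_lim (@norm_hausdorff _ _)) => //.
exact: summability.totally_filter.
Qed.

Lemma normr_sum_le u M : abs_sums_le u M -> `|summability.sum u| <= M.
Proof.
move=> uM; have F := @summability.totally_filter I.
have /cvg_norm h := cvg_partial_sum uM.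
have cv := cvgP _ h; rewrite -(cvg_lim (@norm_hausdorff _ _) h).
apply: limr_le; first exact: cv.
near=> J; rewrite partial_sumE (le_trans (ler_norm_sum _ _ _))//; exact: uM.
Unshelve. all: by end_near. Qed.

Lemma sum_unconditionalB u v M N : abs_sums_le u M -> abs_sums_le v N ->
  summability.sum (fun i => u i - v i) = summability.sum u - summability.sum v.
Proof.
move=> uM vN; have F := @summability.totally_filter I; apply: cvg_partial_sum_eq.
have -> : summability.partial_sum (fun i => u i - v i) =
    (fun J => summability.partial_sum u J - summability.partial_sum v J).
  by apply/funext => J; rewrite !partial_sumE sumrB.
exact: cvgB (cvg_partial_sum uM) (cvg_partial_sum vN).
Qed.

Lemma sum_unconditionalZ u M a : abs_sums_le u M ->
  summability.sum (fun i => a * u i) = a * summability.sum u.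
Proof.
move=> uM; have F := @summability.totally_filter I; apply: cvg_partial_sum_eq.
have -> : summability.partial_sum (fun i => a * u i) =
    (fun J => a * summability.partial_sum u J).
  by apply/funext => J; rewrite !partial_sumE mulr_sumr.
by apply: cvgMr; exact: cvg_partial_sum uM.
Qed.

Lemma sum_unconditional_bij (h h' : I -> I) u M :
  cancel h h' -> cancel h' h -> abs_sums_le u M ->
  summability.sum (u \o h) = summability.sum u.
Proof.
move=> hK h'K uM; have F := @summability.totally_filter I.
apply: cvg_partial_sum_eq => A /(cvg_partial_sum uM)[J0 _ J0A].
exists [fset h' i | i in J0]%fset => // J /= J0J.
have -> : summability.partial_sum (u \o h) J =
    summability.partial_sum u [fset h i | i in J]%fset.
  by rewrite !partial_sumE big_imfset//= => i j _ _ /(can_inj hK).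
apply: J0A; apply/fsubsetP => i iJ0; apply/imfsetP; exists (h' i) => //=.
by apply: (fsubsetP J0J); apply/imfsetP; exists i.
Qed.

End unconditional_sums.

(** * Exhausting a countable index set by a sequence of finite sets *)

Section enumeration.
Context {R : realType} {I : countType}.

(** A cofinal sequence of finite sets: it turns limits along the net into sequential limits, the
    form in which dominated convergence and Borel-Cantelli apply. *)
Definition initial_fset (n : nat) : {fset I} :=
  seq_fset tt (pmap (@pickle_inv I) (iota 0 n)).

Lemma in_initial_fset n (i : I) : (i \in initial_fset n) = (choice.pickle i < n)%N.
Proof.
rewrite seq_fsetE mem_pmap; apply/mapP/idP => [[k]|lein].
  by rewrite mem_iota => kn ik; have := @pickle_invK I k; rewrite -ik/= => ->.
by exists (choice.pickle i); rewrite ?pickleK_inv// mem_iota.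
Qed.

Lemma cvg_initial_sum (u : I -> R) M : abs_sums_le u M ->
  (fun n => \sum_(i <- initial_fset n) u i) @ \oo --> summability.sum u.
Proof.
move=> uM A /(cvg_partial_sum uM)[J _ JA].
exists (\max_(i <- J) (choice.pickle i).+1)%N => // n Jn.
suff : (J `<=` initial_fset n)%fset by move=> /JA; rewrite /= partial_sumE.
apply/fsubsetP => i iJ; rewrite in_initial_fset; apply: leq_trans Jn.
by apply: (@leq_bigmax_seq I (enum_fset J) xpredT (fun i => (choice.pickle i).+1)).
Qed.

End enumeration.

(** * Lattice sums *)

Section lattice.
Context {R : realType} {d : nat}.
Implicit Types (x y z : 'rV[R]_d) (k l m : 'rV[int]_d) (J : {fset 'rV[int]_d}).

Lemma normr_coord_le x i : `|x ord0 i| <= `|x|.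
Proof.
rewrite [leRHS]/Num.Def.normr/= mx_normrE.
exact: (le_bigmax _ (fun ij : 'I_1 * 'I_d => `|x ij.1 ij.2|) (ord0, i)).
Qed.

Lemma normr_le_coord x (M : R) : 0 <= M ->
  (forall i, `|x ord0 i| <= M) -> `|x| <= M.
Proof.
move=> M0 xM; rewrite [leLHS]/Num.Def.normr/= mx_normrE.
by apply/bigmax_leP; split=> // -[i j] _ /=; rewrite ord1.
Qed.

Lemma intvD k l : intv (k + l) = intv k + intv l :> 'rV[R]_d.
Proof. by rewrite /intv map_mxD. Qed.

Lemma intvN k : intv (- k) = - intv k :> 'rV[R]_d.
Proof. by rewrite /intv map_mxN. Qed.

Lemma intvB k l : intv (k - l) = intv k - intv l :> 'rV[R]_d.
Proof. by rewrite intvD intvN. Qed.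

Lemma intv0 : intv 0 = 0 :> 'rV[R]_d.
Proof. by rewrite /intv map_mx0. Qed.

Lemma intv_scale n k : intv (2 ^+ n *: k) = 2 ^+ n *: intv k :> 'rV[R]_d.
Proof. by apply/rowP => i; rewrite !mxE rmorphM rmorphXn. Qed.

Definition floorv x : 'rV[int]_d := \row_i Num.floor (x ord0 i).

Lemma floorv_dist x : `|x - intv (floorv x)| <= 1.
Proof.
apply: normr_le_coord => // i; rewrite !mxE.
have := floor_le (x ord0 i); have := floorD1_gt (x ord0 i); rewrite intrD.
by rewrite ler_norml => h1 h2; apply/andP; split; lra.
Qed.

(** The exponent [2 * d] leaves an exponent 2 for each coordinate: since the max norm dominates
    every coordinate, the weight is at most a product of summable one-dimensional weights. *)
Definition lattice_weight x : R := (1 + `|x|) ^- (2 * d).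

Lemma lattice_weight_ge0 x : 0 <= lattice_weight x.
Proof. by rewrite invr_ge0 exprn_ge0// addr_ge0. Qed.

Lemma lattice_weight_le2 x y : `|x - y| <= 1 ->
  lattice_weight x <= 4 ^+ d * lattice_weight y.
Proof.
move=> xy; rewrite /lattice_weight ler_pdivlMr; last by rewrite exprn_gt0// ltr_wpDr.
rewrite mulrC ler_pdivrMr; last by rewrite exprn_gt0// ltr_wpDr.
rewrite (_ : 4 = 2 ^+ 2) -?exprM; last by rewrite expr2 -natrM.
rewrite -exprMn; apply: lerXn2r; rewrite ?nnegrE ?mulr_ge0 ?addr_ge0//.
have : `|y| <= `|x| + `|x - y|.
  by rewrite -[y in leLHS](subrKC x) -opprB (le_trans (ler_normD _ _))// normrN.
by have := normr_ge0 x; lra.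
Qed.

(** Telescoping: [1 / (n + 2) ^ 2] is at most [1 / (n + 1) - 1 / (n + 2)]. The subtracted term is
    what makes the induction close. *)
Lemma sum_inv_sqr n : \sum_(i < n.+1) (1 + i%:R) ^- 2 <= 2 - n.+1%:R^-1 :> R.
Proof.
elim: n => [|n IH]; first by rewrite big_ord1 addr0 expr1n invr1; lra.
rewrite big_ord_recr/= (le_trans (lerD IH (lexx _)))//.
have -> : 1 + n.+1%:R = n.+2%:R :> R by rewrite -(natr1 n.+1) addrC.
have n1 : (0 : R) < n.+1%:R by [].
have e : n.+2%:R = n.+1%:R + 1 :> R by rewrite -(natr1 n.+1).
suff : n.+2%:R ^- 2 <= n.+1%:R^-1 - n.+2%:R^-1 :> R.
  by rewrite -addrA lerD2l -lerBrDl opprK addrC.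
have -> : n.+1%:R^-1 - n.+2%:R^-1 = (n.+1%:R * n.+2%:R)^-1 :> R.
  have E (a : R) : 0 < a -> a^-1 - (a + 1)^-1 = (a * (a + 1))^-1.
    by move=> a0; field; rewrite !gt_eqF// addr_gt0.
  by rewrite e E.
rewrite lef_pV2 ?posrE ?mulr_gt0 ?exprn_gt0// expr2 ler_pM2r//.
by rewrite ler_nat.
Qed.

Lemma lattice_weight_prod k : lattice_weight (intv k) <=
  \prod_(i < d) (1 + `|k ord0 i|%N%:R) ^- 2.
Proof.
have -> : \prod_(i < d) (1 + `|k ord0 i|%N%:R) ^- 2 =
    (\prod_(i < d) (1 + `|k ord0 i|%N%:R) ^+ 2)^-1 :> R by rewrite prodfV.
rewrite lef_pV2 ?posrE ?exprn_gt0 ?ltr_wpDr//; last first.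
  by apply: prodr_gt0 => i _; rewrite exprn_gt0// ltr_wpDr.
rewrite exprM -[X in _ <= _ ^+ X]card_ord -prodr_const; apply: ler_prod => i _.
rewrite exprn_ge0 ?addr_ge0//=; apply: lerXn2r; rewrite ?nnegrE ?addr_ge0//.
rewrite lerD2l; apply: le_trans (normr_coord_le (intv k) i).
by rewrite mxE -intr_norm natr_absz.
Qed.

(** Encoding each coordinate by its absolute value and sign embeds [J] into a finite function space,
    over which the sum of products is a product of sums. Each factor is at most [2 * 2], whence
    [4 ^+ d]. *)
Lemma sum_lattice_weight_intv J :
  \sum_(k <- J) lattice_weight (intv k) <= 4 ^+ d.
Proof.
pose N := (\max_(k <- J) \max_i `|k ord0 i|)%N.
have kN k i : k \in J -> (`|k ord0 i| < N.+1)%N.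
  move=> kJ; rewrite ltnS.
  apply: leq_trans (@leq_bigmax_seq _ (enum_fset J) xpredT
    (fun k => \max_i `|k ord0 i|)%N k kJ isT).
  exact: (@leq_bigmax 'I_d (fun i => `|k ord0 i|%N) i).
pose F (i : 'I_d) (p : 'I_N.+1 * bool) : R := (1 + (p.1 : nat)%:R) ^- 2.
pose c (k : J) : {ffun 'I_d -> 'I_N.+1 * bool} :=
  [ffun i => (inord `|val k ord0 i|, val k ord0 i < 0)].
have cI : injective c.
  move=> k l /ffunP kl; apply/val_inj/rowP => i.
  have := kl i; rewrite !ffunE => -[/(congr1 val)/=].
  rewrite !inordK ?kN ?fsvalP// => e1 e2.
  by rewrite [LHS]intEsign [RHS]intEsign e1 e2.
rewrite big_seq_fsetE/=.
apply: (@le_trans _ _ (\sum_(k : J) \prod_i F i (c k i))).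
  apply: ler_sum => k _; apply: le_trans (lattice_weight_prod _) _.
  apply: ler_prod => i _; rewrite invr_ge0 exprn_ge0 ?addr_ge0//=.
  by rewrite /F ffunE /= inordK// kN ?fsvalP.
apply: (@le_trans _ _ (\sum_(f : {ffun 'I_d -> 'I_N.+1 * bool}) \prod_i F i (f i))).
  have F0 (f : {ffun 'I_d -> 'I_N.+1 * bool}) : 0 <= \prod_i F i (f i).
    by apply: prodr_ge0 => i _; rewrite invr_ge0 exprn_ge0 ?addr_ge0.
  pose G (f : {ffun 'I_d -> 'I_N.+1 * bool}) := \prod_i F i (f i).
  rewrite -(@big_imset _ _ _ _ _ c predT G)/=; last by move=> k l _ _ /cI.
  rewrite [leRHS](bigID (mem [set c k | k in predT]%SET))/= lerDl.
  by apply: sumr_ge0 => f _; exact: F0.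
rewrite -bigA_distr_bigA/= -[X in _ <= _ ^+ X]card_ord -prodr_const.
apply: ler_prod => i _; rewrite sumr_ge0/=; last first.
  by move=> p _; rewrite invr_ge0 exprn_ge0 ?addr_ge0.
rewrite -(pair_bigA _ (fun (n : 'I_N.+1) (b : bool) => (1 + (n : nat)%:R) ^- 2))/=.
under eq_bigr do rewrite big_bool.
rewrite big_split/=; have := sum_inv_sqr N.
have : (0 : R) <= N.+1%:R^-1 by rewrite invr_ge0.
by move: (_^-1) (\sum_(i < _) _) => a b; lra.
Qed.

(** Rounding [z] to [floorv z] moves each point by at most 1, which costs a factor [4 ^+ d]; the
    reindexed lattice sum costs another. *)
Lemma sum_lattice_weight z J :
  \sum_(k <- J) lattice_weight (z - intv k) <= 16 ^+ d.
Proof.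
have -> : (16 : R) ^+ d = 4 ^+ d * 4 ^+ d by rewrite -exprMn -natrM.
pose h k := floorv z - k.
have hI : injective h by move=> k l /addrI/oppr_inj.
apply: (@le_trans _ _ (4 ^+ d * \sum_(k <- J) lattice_weight (intv (h k)))).
  rewrite mulr_sumr; apply: ler_sum => k _; apply: lattice_weight_le2.
  rewrite /h intvB (_ : _ - _ = z - intv (floorv z)) ?floorv_dist//.
  by rewrite opprB addrA subrK.
rewrite ler_pM2l ?exprn_gt0//.
have : abs_sums_le (fun k => lattice_weight (intv k)) (4 ^+ d).
  move=> J'; apply: le_trans (sum_lattice_weight_intv J').
  by apply: ler_sum => k _; rewrite ger0_norm// lattice_weight_ge0.
move=> /(abs_sums_le_comp hI)/(_ J); apply: le_trans.
by apply: ler_sum => k _; exact: ler_norm.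
Qed.

End lattice.

(** * Affine changes of variables *)

Section affine.
Context {R : realType}.

Lemma lebesgue_measure_affine (a c : R) (A : set R) : 0 < a -> measurable A ->
  lebesgue_measure A = (a%:E * lebesgue_measure ((fun t => a * t - c)%R @^-1` A))%E.
Proof.
move=> a0; pose T t : R := a * t - c.
have mT : measurable_fun setT (T : measurableTypeR R -> measurableTypeR R).
  by apply: measurable_funB => //; exact: measurable_funM.
pose T' : {mfun measurableTypeR R >-> measurableTypeR R} :=
  HB.pack T (isMeasurableFun.Build _ _ _ _ _ mT).
apply: (@lebesgue_measure_unique _
  (mscale (NngNum (ltW a0)) (pushforward lebesgue_measure T'))).
move=> _ [[u v] _ <-]/=.
rewrite /mscale/= /pushforward.
have -> : T @^-1` `]u, v] = `](u + c) / a, (v + c) / a]%classic.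
  apply/seteqP; split=> t; rewrite /T/= !in_itv/= ltr_pdivrMr// ler_pdivlMr//;
  by rewrite ltrBrDr lerBlDr (mulrC a).
rewrite !lebesgue_measure_itv/= !lte_fin ltr_pM2r ?invr_gt0// ltrD2r.
case: ifPn => _; last by rewrite mule0.
by rewrite -!EFinD -EFinM; congr (_%:E); field; rewrite gt_eqF.
Qed.

Context {d : nat}.
Implicit Types (A D : set 'rV[R]_d) (c : 'rV[R]_d) (a : R).
Notation mu := (lebesgue_rV d).

Definition box (A : 'I_d -> set R) : set 'rV[R]_d :=
  [set x | forall i, A i (x ord0 i)].

Lemma measurable_box (A : 'I_d -> set R) :
  (forall i, measurable (A i)) -> measurable (box A).
Proof.
move=> mA; have -> : box A = \bigcap_(i in [set: 'I_d])
    ([set: 'rV[R]_d] `&` (fun x => x ord0 i) @^-1` (A i)).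
  by apply/seteqP; split=> [x h i _|x h i]; [split=> //; exact: h|have [] := h i I].
by apply: fin_bigcap_measurable => // i _; exact: measurable_coord.
Qed.

Lemma measurable_affine a c :
  measurable_fun setT (fun x : 'rV[R]_d => a *: x - c).
Proof.
apply: measurable_fun_rowP => i.
rewrite (_ : (fun _ => _) = (fun x : 'rV[R]_d => a * x ord0 i - c ord0 i)).
  by apply: measurable_funB => //; apply: measurable_funM => //; exact: measurable_coord.
by apply/funext => x; rewrite !mxE.
Qed.

(** Boxes are stable under intersection and their measure is known, so this presentation allows
    measures to be identified by their values on boxes. *)
Lemma measurable_rV_boxes : measurable =
  <<s [set box A | A in [set A : 'I_d -> set R | forall i, measurable (A i)]] >>.
Proof.
apply/seteqP; split; last first.
  apply: smallest_sub; first exact: sigma_algebra_measurable.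
  by move=> _ [A mA <-]; exact: measurable_box.
apply: smallest_sub; first exact: smallest_sigma_algebra.
move=> B; rewrite -bigcup_seq => -[i _ [C mC <-]].
apply: sub_sigma_algebra; exists (fun j => if j == i then C else setT).
  by move=> j; case: ifP.
rewrite setTI; apply/seteqP; split => x /=; last by move=> ? j; case: eqP => // ->.
by move=> /(_ i); rewrite eqxx.
Qed.

(** Both sides are measures in [A]. They agree on boxes by the one-dimensional case, and the cubes
    []- k, k]] of finite measure exhaust the space. *)
Lemma lebesgue_rV_affine a c A : 0 < a -> measurable A ->
  mu A = ((a ^+ d)%:E * mu ((fun x => a *: x - c)%R @^-1` A))%E.
Proof.
move=> a0; pose T := fun x : 'rV[R]_d => a *: x - c.
have mT : measurable_fun setT T by exact: measurable_affine.
pose T' : {mfun 'rV[R]_d >-> 'rV[R]_d} :=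
  HB.pack T (isMeasurableFun.Build _ _ _ _ _ mT).
have ad0 : 0 <= a ^+ d by rewrite exprn_ge0// ltW.
apply: (measure_unique
  [set box A | A in [set A : 'I_d -> set R | forall i, measurable (A i)]]
  (fun k : nat => box (fun=> `]- k%:R, k%:R]%classic)) measurable_rV_boxes
  _ _ _ mu (mscale (NngNum ad0) (pushforward mu T'))) => /=.
- move=> _ _ [A1 mA1 <-] [A2 mA2 <-]; exists (fun i => A1 i `&` A2 i).
    by move=> i; exact: measurableI.
  by apply/seteqP; split => x /= => [h|[h1 h2 i]]; [split => i; have [] := h i|split].
- by move=> k; exists (fun=> `]- k%:R, k%:R]%classic).
- apply/seteqP; split => // x _; exists (Num.trunc `|x|).+1 => //= i.
  have := truncnS_gt `|x|; have := normr_coord_le x i.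
  rewrite /= in_itv/= ler_norml => /andP[h1 h2] h3.
  by apply/andP; split; lra.
- move=> _ [A1 mA1 <-]; rewrite lebesgue_rV_box// /mscale/= /pushforward.
  have -> : T @^-1` box A1 = box (fun i => (fun t => a * t - c ord0 i) @^-1` A1 i).
    by apply/seteqP; split => x /= h i; have := h i; rewrite !mxE.
  rewrite lebesgue_rV_box; last first.
    move=> i; rewrite -[X in measurable X]setTI.
    have : measurable_fun setT (fun t => a * t - c ord0 i).
      by apply: measurable_funB => //; exact: measurable_funM.
    by apply.
  under eq_bigr => i _ do rewrite (lebesgue_measure_affine (c ord0 i) a0)//.
  rewrite big_split/= prodEFin; congr ((_%:E * _)%E).
  by rewrite prodr_const card_ord.
- move=> k; rewrite lebesgue_rV_box//.
  have kk : lebesgue_measure `]- k%:R, k%:R]%classic = (k%:R + k%:R : R)%:E.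
    rewrite lebesgue_measure_itv/= lte_fin -subr_gt0 -EFinB opprK.
    case: ltrP => // h; congr (_%:E); apply/eqP.
    by rewrite eq_le h andbT addr_ge0.
  by under eq_bigr do rewrite kk; rewrite prodEFin ltry.
Qed.

Lemma ge0_integral_affine a c D (g : 'rV[R]_d -> \bar R) : 0 < a ->
  measurable D -> measurable_fun setT g -> (forall x, 0 <= g x)%E ->
  (\int[mu]_(x in D) g x =
  (a ^+ d)%:E * \int[mu]_(x in (fun x => a *: x - c)%R @^-1` D) g (a *: x - c)%R)%E.
Proof.
move=> a0 mD mg g0; pose T := fun x : 'rV[R]_d => a *: x - c.
have mT : measurable_fun setT T by exact: measurable_affine.
pose T' : {mfun 'rV[R]_d >-> 'rV[R]_d} :=
  HB.pack T (isMeasurableFun.Build _ _ _ _ _ mT).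
have ad0 : 0 <= a ^+ d by rewrite exprn_ge0// ltW.
rewrite (eq_measure_integral (mscale (NngNum ad0) (pushforward mu T'))); last first.
  by move=> A mA _; exact: (lebesgue_rV_affine c a0 mA).
rewrite ge0_integral_mscale//; last exact: measurable_funTS.
by rewrite ge0_integral_pushforward//; exact: measurable_funTS.
Qed.

Lemma integrable_affine a c (g : 'rV[R]_d -> R) : 0 < a ->
  mu.-integrable setT (EFin \o g) ->
  mu.-integrable setT (EFin \o (fun x => g (a *: x - c))).
Proof.
move=> a0 /integrableP[/measurable_EFinP mg goo]; apply/integrableP; split.
  by apply/measurable_EFinP; apply: measurableT_comp => //; exact: measurable_affine.
have ad0 : (0 < (a ^+ d)%:E)%E by rewrite lte_fin exprn_gt0.
move: goo; rewrite (ge0_integral_affine c a0)//; last first.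
  by apply: measurableT_comp => //; exact/measurable_EFinP.
rewrite preimage_setT /comp/=.
by case: (integral _ _ _) => [r| |] //; rewrite ?ltry// gt0_muley// ltxx.
Qed.

Lemma Rintegral_affine a c D (g : 'rV[R]_d -> R) : 0 < a ->
  measurable D -> mu.-integrable setT (EFin \o g) ->
  \int[mu]_(x in D) g x =
  a ^+ d * \int[mu]_(x in (fun x => a *: x - c) @^-1` D) g (a *: x - c).
Proof.
move=> a0 mD ig; have igT := integrable_affine c a0 ig.
have mTD : measurable ((fun x => a *: x - c) @^-1` D).
  by rewrite -[X in measurable X]setTI; exact: measurable_affine.
have igTD := integrableS measurableT mTD (@subsetT _ _) igT.
have /measurable_EFinP mg := measurable_int _ ig.
rewrite /Rintegral -[a ^+ d]/(fine (a ^+ d)%:E) -fineM//; last exact: integrable_fin_num.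
congr fine; rewrite [LHS]integralE [in RHS]integralE muleBr//; last first.
  exact: integrable_add_def igTD.
congr (_ - _)%E.
  rewrite (ge0_integral_affine c a0)//; last first.
    by apply: measurable_funepos; exact/measurable_EFinP.
  by congr (_ * _)%E; apply: eq_integral => x _; rewrite ?funeposE ?funenegE.
rewrite (ge0_integral_affine c a0)//; last first.
  by apply: measurable_funeneg; exact/measurable_EFinP.
by congr (_ * _)%E; apply: eq_integral => x _; rewrite ?funeposE ?funenegE.
Qed.

End affine.

(** * Unit cells and periodization *)

Lemma big_initial_fset {R : nmodType} {I : countType} (h : I -> R) n :
  \sum_(k <- initial_fset n) h k = \sum_(i <- iota 0 n) oapp h 0 (pickle_inv i).
Proof.
rewrite /initial_fset (perm_big _ (seq_fset_perm _ _)) undup_id ?big_pmap//.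
by apply: pmap_uniq (iota_uniq _ _); exact: pickle_invK.
Qed.

Section cells.
Context {R : realType} {d : nat}.
Implicit Types (x y : 'rV[R]_d) (k l : 'rV[int]_d).
Notation mu := (@lebesgue_rV R d).

(** The cube [k + [0, 1) ^ d]; as fibres of [floorv] the cells visibly partition the space. *)
Definition cell k : set 'rV[R]_d := [set x | floorv x = k].

Lemma cellE k : cell k =
  box (fun i => `[(k ord0 i)%:~R, (k ord0 i)%:~R + 1[%classic).
Proof.
apply/seteqP; split => x /=.
  move=> <- i; rewrite /= in_itv/= !mxE floor_le/=.
  by have := floorD1_gt (x ord0 i); rewrite intrD.
move=> h; apply/rowP => i; rewrite !mxE; apply: floor_def.
by have := h i; rewrite /= in_itv/= intrD.
Qed.

Lemma unit_cubeE : unit_cube = cell 0.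
Proof.
rewrite cellE; apply/seteqP; split => x h i; have := h i;
  by rewrite /= in_itv/= mxE add0r.
Qed.

Lemma measurable_cell k : measurable (cell k).
Proof. by rewrite cellE; apply: measurable_box => i; exact: measurable_itv. Qed.

Lemma lebesgue_cell k : mu (cell k) = 1%E.
Proof.
rewrite cellE lebesgue_rV_box; last by move=> i; exact: measurable_itv.
rewrite big1// => i _; rewrite lebesgue_measure_itv/= lte_fin ltrDl ltr01.
by rewrite -EFinB addrAC subrr add0r.
Qed.

Lemma floorvBz x k : floorv (x - intv k) = floorv x - k.
Proof.
apply/rowP => i; rewrite !mxE; apply: floor_def; rewrite !intrD intrN.
have := floor_le (x ord0 i); have := floorD1_gt (x ord0 i); rewrite intrD.
by move=> h1 h2; apply/andP; split; lra.
Qed.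

Lemma measurable_comp_floorv (g : 'rV[int]_d -> R) :
  measurable_fun setT (g \o floorv : 'rV[R]_d -> R).
Proof.
move=> _ Y mY; rewrite setTI.
rewrite (_ : _ @^-1` _ = \bigcup_k (if k \in g @^-1` Y then cell k else set0)).
  apply: countable_bigcupT_measurable => [|k]; first exact: countableP.
  by case: ifPn => _ //; exact: measurable_cell.
apply/seteqP; split => x /=.
  by move=> Yx; exists (floorv x) => //; rewrite mem_set.
by move=> [k _]; case: ifPn => //; rewrite inE /cell/= => + ->.
Qed.

Lemma dyadic_approx n x :
  `|x - 2 ^- n *: intv (floorv (2 ^+ n *: x))| <= 2 ^- n.
Proof.
have -> : x - 2 ^- n *: intv (floorv (2 ^+ n *: x)) =
    2 ^- n *: (2 ^+ n *: x - intv (floorv (2 ^+ n *: x))).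
  by rewrite scalerBr scalerA mulVf ?expf_neq0// scale1r.
by rewrite normrZ ger0_norm ?invr_ge0 ?exprn_ge0// ler_piMr ?invr_ge0 ?exprn_ge0// floorv_dist.
Qed.

(** The sigma-algebra is generated by the coordinates rather than by open sets. Rounding the
    argument to the grid of mesh [2 ^- n] gives measurable functions, constant on countably many
    cells, that converge to [f] by continuity. *)
Lemma measurable_continuous_rV (f : 'rV[R]_d -> R) :
  continuous f -> measurable_fun setT f.
Proof.
move=> cf; pose s n x := 2 ^- n *: intv (floorv (2 ^+ n *: x)) : 'rV[R]_d.
apply: (@measurable_fun_cvg _ _ _ setT (fun n x => f (s n x))).
  move=> n; apply: (measurableT_comp
    (measurable_comp_floorv (fun k => f (2 ^- n *: intv k)))).
  have := @measurable_affine R d (2 ^+ n) 0.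
  by under eq_fun do rewrite subr0.
move=> x _; apply: continuous_cvg; first exact: cf.
apply/cvgrPdist_le => e e0.
have h : 2^-1 ^+ n @[n --> \oo] --> (0 : R).
  by apply: cvg_expr; rewrite ger0_norm ?invf_lt1 ?ltr1n.
have /cvgrPdist_le/(_ e e0) := h.
apply: filterS => n; rewrite sub0r normrN ger0_norm ?exprn_ge0// => ne.
by apply: le_trans ne; rewrite exprVn; exact: dyadic_approx.
Qed.

(** On a cell the weight is at most [4 ^+ d] times its value at the corner, and the corner values
    sum to at most [4 ^+ d]; this is the origin of [16 ^+ d]. *)
Lemma integrable_decay (g : 'rV[R]_d -> R) (C : R) : measurable_fun setT g ->
  (forall x, `|g x| <= C * lattice_weight x) ->
  mu.-integrable setT (EFin \o g) /\ `|\int[mu]_x g x| <= C * 16 ^+ d.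
Proof.
move=> mg gC.
have C0 : 0 <= C.
  have := le_trans (normr_ge0 _) (gC 0).
  by rewrite /lattice_weight normr0 addr0 expr1n invr1 mulr1.
(* Integers that are not codes of lattice points get the empty set here, and the bound 0 in [c]. *)
pose F n := oapp cell (set0 : set 'rV[R]_d) (pickle_inv n).
pose c n : R := oapp (fun k => C * (4 ^+ d * lattice_weight (intv k))) 0
  (pickle_inv n : option 'rV[int]_d).
have c0 n : 0 <= c n.
  rewrite /c; case: pickle_inv => //= k.
  by rewrite !mulr_ge0 ?exprn_ge0 ?lattice_weight_ge0.
have mF n : measurable (F n).
  by rewrite /F; case: pickle_inv => //= k; exact: measurable_cell.
have FT : \bigcup_n F n = setT.
  apply/seteqP; split => // x _; exists (choice.pickle (floorv x)) => //.
  by rewrite /F pickleK_inv.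
have tF : trivIset setT F.
  apply/trivIsetP => i j _ _ ij; apply/seteqP; split => // x [].
  rewrite /F; have := @pickle_invK 'rV[int]_d i; have := @pickle_invK 'rV[int]_d j.
  case: (pickle_inv i) => [k|//]; case: (pickle_inv j) => [l|//]/= lj ki.
  by rewrite /cell/= => xk xl; move: ij; rewrite -lj -ki -xk -xl eqxx.
have mabs : measurable_fun setT (fun x => `|(g x)%:E|)%E.
  by apply: measurableT_comp => //; exact/measurable_EFinP.
have le : (\int[mu]_x `|(g x)%:E| <= (C * 16 ^+ d)%:E)%E.
  rewrite -FT ge0_integral_bigcup//; last by rewrite FT.
  apply: (@le_trans _ _ (\sum_(i <oo) (c i)%:E)%E).
    apply: lee_nneseries => [i *|i *]; first by apply: integral_ge0.
    apply: (@le_trans _ _ (\int[mu]_(x in F i) (cst (c i)%:E x))%E).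
      apply: ge0_le_integral => //; first exact: measurable_funTS.
      move=> x; rewrite /F /c; case: pickle_inv => //= k xk.
      rewrite lee_fin (le_trans (gC x))// ler_wpM2l//.
      by apply: lattice_weight_le2; rewrite -xk floorv_dist.
    rewrite integral_cst// /F /c; case: pickle_inv => [k|]/=.
      by rewrite lebesgue_cell mule1.
    by rewrite measure0 mule0.
  apply: lime_le; first by apply: is_cvg_nneseries => n _ _; rewrite lee_fin.
  apply: nearW => n; rewrite sumEFin lee_fin /index_iota subn0 -big_initial_fset.
  rewrite -mulr_sumr ler_wpM2l// -mulr_sumr.
  have -> : (16 : R) ^+ d = 4 ^+ d * 4 ^+ d by rewrite -exprMn -natrM.
  by rewrite ler_wpM2l ?exprn_ge0// sum_lattice_weight_intv.
have ig : mu.-integrable setT (EFin \o g).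
  apply/integrableP; split; first exact/measurable_EFinP.
  exact: le_lt_trans le (ltry _).
split=> //; apply: le_trans (le_normr_Rintegral _ ig) _ => //.
rewrite -lee_fin /Rintegral fineK//.
rewrite ge0_fin_numE; last by apply: integral_ge0 => x _; rewrite lee_fin.
exact: le_lt_trans le (ltry _).
Qed.

End cells.

(** Dominated convergence along [initial_fset]; the bound [g] on absolute sums dominates all partial
    sums at once. *)
Lemma cvg_sum_Rintegral {dd} {T : measurableType dd} {R : realType}
    {I : countType} (nu : {measure set T -> \bar R}) (D : set T)
    (h : I -> T -> R) (g : T -> R) :
  measurable D -> (forall k, nu.-integrable D (EFin \o h k)) ->
  nu.-integrable D (EFin \o g) ->
  (forall x, D x -> abs_sums_le (h ^~ x) (g x)) ->
  (fun n => \sum_(k <- initial_fset n) \int[nu]_(x in D) h k x) @ \oo -->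
  \int[nu]_(x in D) summability.sum (h ^~ x).
Proof.
move=> mD ih ig hg.
pose S n x := \sum_(k <- initial_fset n) h k x.
have mS n : measurable_fun D (S n).
  apply: measurable_sum => k; apply/measurable_EFinP.
  exact: measurable_int (ih k).
have cS x : D x -> S^~ x @ \oo --> summability.sum (h ^~ x).
  by move=> Dx; exact: cvg_initial_sum (hg x Dx).
have mL : measurable_fun D (fun x => summability.sum (h ^~ x)).
  exact: measurable_fun_cvg mS cS.
have [iL _ cvS] := @dominated_convergence _ _ _ nu D mD
  (fun n x => (S n x)%:E) (fun x => (summability.sum (h ^~ x))%:E)
  (fun x => (g x)%:E)
  ltac:(by move=> n; exact/measurable_EFinP) ltac:(exact/measurable_EFinP)
  ltac:(by apply: aeW => x Dx; apply: cvg_EFin; [exact: nearW|exact: cS]) ig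
  ltac:(by apply: aeW => x n Dx; rewrite lee_fin
    (le_trans (ler_norm_sum _ _ _))//; exact: hg).
have Sfin n : (\int[nu]_(x in D) (S n x)%:E)%E =
    (\sum_(k <- initial_fset n) \int[nu]_(x in D) h k x)%:E.
  under eq_integral do rewrite /S -sumEFin.
  rewrite integral_sum// -sumEFin; apply: eq_bigr => k _.
  by rewrite /Rintegral fineK//; exact: (integrable_fin_num mD (ih k)).
move: cvS; rewrite -(fineK (integrable_fin_num mD iL)) => /fine_cvg.
rewrite (_ : fine \o _ = fun n => \sum_(k <- initial_fset n) \int[nu]_(x in D) h k x)//.
by apply/funext => n /=; rewrite Sfin.
Qed.

Section periodization.
Context {R : realType} {d : nat}.
Notation mu := (@lebesgue_rV R d).

(** Unfolding: the integral of a translate over the unit cube is the integral of [F] over a cell.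
    Both sides are therefore limits of the same partial sums, one from the translates and one from
    the pieces [h k] of [F] cut along the cells. *)
Lemma Rintegral_periodization (F : 'rV[R]_d -> R) (M : R) :
  mu.-integrable setT (EFin \o F) ->
  (forall x, abs_sums_le (fun k => F (x - intv k)) M) ->
  \int[mu]_(x in unit_cube) summability.sum (fun k => F (x - intv k)) =
  \int[mu]_x F x.
Proof.
move=> iF FM.
have /measurable_EFinP mF := measurable_int _ iF.
have iFk k : mu.-integrable setT (EFin \o (fun x => F (x - intv k))).
  have := integrable_affine (intv k) ltr01 iF.
  by apply: eq_integrable => // x _ /=; rewrite scale1r.
have mcube : measurable (@unit_cube R d) by rewrite unit_cubeE; exact: measurable_cell.
have c1 := @cvg_sum_Rintegral _ _ _ _ mu unit_cube (fun k x => F (x - intv k))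
  (cst M) mcube (fun k => integrableS measurableT mcube (@subsetT _ _) (iFk k)).
have {c1} := c1 _ (fun x _ => FM x).
have -> : mu.-integrable unit_cube (EFin \o cst M).
  apply/integrableP; split; first exact/measurable_EFinP.
  rewrite (eq_integral (cst `|M%:E|%E))// integral_cst//= unit_cubeE.
  by rewrite lebesgue_cell mule1 ltry.
move=> /(_ isT) c1.
pose h k x : R := F x * \1_(cell (- k)) x.
have ih k : mu.-integrable setT (EFin \o h k).
  apply: le_integrable iF => //.
    apply/measurable_EFinP/measurable_funM => //.
    by apply: measurable_indic; exact: measurable_cell.
  move=> x _; rewrite lee_fin /h indicE normrM.
  by case: (_ \in _); rewrite ?normr1 ?mulr1// normr0 mulr0.
have hx x k : h k x = if k == - floorv x then F x else 0.
  rewrite /h indicE -[k == _]eqr_opp opprK eq_sym; case: eqP => [e|ne].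
    by rewrite mem_set ?mulr1.
  by rewrite memNset ?mulr0// => /ne.
have sumh x (J : {fset 'rV[int]_d}) (G : R -> R) : G 0 = 0 ->
    - floorv x \in J -> \sum_(k <- J) G (h k x) = G (F x).
  move=> G0 xJ; rewrite (bigD1_seq (- floorv x)) ?fset_uniq//= hx eqxx.
  by rewrite big1 ?addr0// => k /negbTE nk; rewrite hx nk.
have hF x : abs_sums_le (h ^~ x) `|F x|.
  move=> J; have [xJ|xJ] := boolP (- floorv x \in J).
    by rewrite (sumh x J (fun t => `|t|)) ?normr0.
  rewrite big_seq big1// => k kJ; rewrite hx; case: eqP => [e|_]; last by rewrite normr0.
  by move: xJ; rewrite -e kJ.
have hS x : summability.sum (h ^~ x) = F x.
  apply: cvg_partial_sum_eq => A /nbhs_singleton AF.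
  exists [fset - floorv x]%fset => // J /= xJ; rewrite partial_sumE.
  by rewrite (sumh x J id)//; apply: (fsubsetP xJ); rewrite inE.
have c2 := @cvg_sum_Rintegral _ _ _ _ mu setT h (fun x => `|F x|) measurableT ih
  (integrable_norm iF) (fun x _ => hF x).
have hE k : \int[mu]_(x in unit_cube) F (x - intv k) = \int[mu]_x h k x.
  have -> : \int[mu]_x h k x = \int[mu]_(x in cell (- k)) F x.
    rewrite [RHS]Rintegral_mkcond; apply: eq_Rintegral => x _.
    by rewrite patchE /h indicE; case: ifPn => _; rewrite ?mulr1 ?mulr0.
  rewrite (Rintegral_affine (intv k) ltr01 (measurable_cell _) iF) expr1n mul1r.
  have -> : (fun x : 'rV[R]_d => 1 *: x - intv k) @^-1` cell (- k) = unit_cube.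
    rewrite unit_cubeE; apply/seteqP; split => x /=; rewrite /cell/= scale1r floorvBz.
      by rewrite -[- k in RHS]add0r => /addIr.
    by move=> ->; rewrite sub0r.
  by apply: eq_Rintegral => x _; rewrite scale1r.
have {}c1 := cvg_lim (@Rhausdorff R) c1; have {}c2 := cvg_lim (@Rhausdorff R) c2.
rewrite -c1; under eq_fun do under eq_bigr do rewrite hE.
by rewrite c2; apply: eq_Rintegral => x _; rewrite hS.
Qed.

End periodization.

(** * Decay and smoothness *)

Lemma mean_value_le {R : realType} (f : R -> R) (a b L : R) :
  (forall u, derivable f u 1) ->
  (forall u, Num.min a b <= u <= Num.max a b -> `|'D_1 f u| <= L) ->
  `|f b - f a| <= L * `|b - a|.
Proof.
move=> df; wlog ab : a b / a <= b => [H|].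
  have /orP[ab|ba] := le_total a b; first exact: H.
  by move=> h; rewrite distrC [X in _ * X]distrC; apply: H => // u; rewrite minC maxC; exact: h.
rewrite min_l// max_r// => f'L.
have [c cab ->] : exists2 c, c \in `[a, b] & f b - f a = 'D_1 f c * (b - a).
  apply: MVT_segment => //.
  by apply: derivable_within_continuous => x _; exact: df.
by rewrite normrM ler_wpM2r// f'L// -in_itv.
Qed.

Section smooth_decay.
Context {R : realType} {d : nat}.
Implicit Types (x y : 'rV[R]_d) (g : 'rV[R]_d -> R).

Lemma derivable_line g x (s : 'I_d) u :
  derivable g (x + u *: delta_mx ord0 s) (delta_mx ord0 s) ->
  derivable (fun u : R => g (x + u *: delta_mx ord0 s)) u 1 /\
  'D_1 (fun u : R => g (x + u *: delta_mx ord0 s)) u =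
    'D_(delta_mx ord0 s) g (x + u *: delta_mx ord0 s).
Proof.
have E : (fun h : R => h^-1 *: (((fun u : R => g (x + u *: delta_mx ord0 s)) \o shift u)
      (h *: 1) - g (x + u *: delta_mx ord0 s))) =
    (fun h : R => h^-1 *: ((g \o shift (x + u *: delta_mx ord0 s))
      (h *: delta_mx ord0 s) - g (x + u *: delta_mx ord0 s))).
  apply/funext => h /=; congr (_ *: (g _ - _)).
  have -> : h *: (1 : R) = h by exact: mulr1.
  by rewrite scalerDl addrCA.
by rewrite /derivable /derive E.
Qed.

Lemma line_le g x (s : 'I_d) (a b L : R) :
  (forall z, derivable g z (delta_mx ord0 s)) ->
  (forall u, Num.min a b <= u <= Num.max a b ->
    `|'D_(delta_mx ord0 s) g (x + u *: delta_mx ord0 s)| <= L) ->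
  `|g (x + b *: delta_mx ord0 s) - g (x + a *: delta_mx ord0 s)| <= L * `|b - a|.
Proof.
move=> dg gL; apply: (@mean_value_le _ (fun u => g (x + u *: delta_mx ord0 s))).
  by move=> u; have [] := derivable_line (dg (x + u *: delta_mx ord0 s)).
move=> u /gL; have [_ ->] := derivable_line (dg (x + u *: delta_mx ord0 s)).
by [].
Qed.

(* Change the coordinates of [x] into those of [y] one at a time. *)
Lemma partials_le g x y (L : R) :
  (forall s z, derivable g z (delta_mx ord0 s)) ->
  (forall s z, `|z - x| <= `|y - x| -> `|'D_(delta_mx ord0 s) g z| <= L) ->
  `|g y - g x| <= d%:R * L * `|y - x|.
Proof.
move=> dg gL; pose z (t : nat) : 'rV[R]_d :=
  \row_i (if (i < t)%N then y ord0 i else x ord0 i).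
have z0 : z 0%N = x by apply/rowP => i; rewrite mxE.
have zd : z d = y by apply/rowP => i; rewrite mxE ltn_ord.
have -> : g y - g x = \sum_(0 <= t < d) (g (z t.+1) - g (z t)).
  by rewrite telescope_sumr// z0 zd.
rewrite big_mkord (le_trans (ler_norm_sum _ _ _))//.
have -> : d%:R * L * `|y - x| = \sum_(s < d) L * `|y - x|.
  by rewrite sumr_const card_ord -mulrA mulr_natl.
apply: ler_sum => s _.
(* [z s] and [z s.+1] differ only in coordinate [s], so both lie on the line through [p] in that
   direction. *)
pose p : 'rV[R]_d := \row_i (if (i < s)%N then y ord0 i else
  if i == s then 0 else x ord0 i).
have -> : z s.+1 = p + y ord0 s *: delta_mx ord0 s.
  apply/rowP => i; rewrite !mxE eqxx/= ltnS leq_eqVlt -[(i == s :> nat)]/(i == s).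
  case: eqP => [->|_]/=; first by rewrite ltnn add0r mulr1.
  by rewrite mulr0 addr0.
have -> : z s = p + x ord0 s *: delta_mx ord0 s.
  apply/rowP => i; rewrite !mxE eqxx/=; case: eqP => [->|_]/=.
    by rewrite ltnn add0r mulr1.
  by rewrite mulr0 addr0.
have L0 : 0 <= L by apply: le_trans (gL s x _); rewrite // subrr normr0.
apply: (@le_trans _ _ (L * `|y ord0 s - x ord0 s|)); last first.
  by rewrite ler_wpM2l//; have := normr_coord_le (y - x) s; rewrite !mxE.
apply: line_le => [w|u uxy]; first exact: dg.
apply: gL; apply: normr_le_coord => // i.
apply: (@le_trans _ _ `|y ord0 i - x ord0 i|); last first.
  by have := normr_coord_le (y - x) i; rewrite !mxE.
rewrite !mxE eqxx/=; case: eqP => [->|_]/=.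
  rewrite ltnn add0r mulr1; move: uxy; rewrite ge_min le_max.
  have [xy|/ltW yx] := leP (x ord0 s) (y ord0 s).
    move=> /andP[/orP[h1|h1] /orP[h2|h2]]; rewrite !ger0_norm ?subr_ge0//; lra.
  move=> /andP[/orP[h1|h1] /orP[h2|h2]]; rewrite !ler0_norm ?subr_le0//; lra.
by rewrite mulr0 addr0; case: ifPn => _ //; rewrite subrr normr0.
Qed.

Lemma lattice_weight_le1 x : lattice_weight x <= 1.
Proof.
rewrite /lattice_weight invf_le1 ?exprn_gt0 ?ltr_wpDr//.
by rewrite exprn_ege1// lerDl.
Qed.

(** Decay of order [2 * d + 1] for [g] pays for the factor [1 + |x|]; decay of order [2 * d] for the
    partial derivatives gives the increment bound. *)
Lemma smooth_fast_decay1P g : smooth_fast_decay 1 g ->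
  exists2 C, 0 < C &
    (forall x, (1 + `|x|) * `|g x| <= C * lattice_weight x) /\
    (forall x y, `|g x - g y| <=
      C * Num.min 1 `|x - y| * (lattice_weight x + lattice_weight y)).
Proof.
move=> [/(_ (2 * d).+1)[C0 gC0] Dg].
have /choice[C1 gC1] : forall s, exists C, forall x,
    `|'D_(delta_mx ord0 s) g x| <= C * lattice_weight x.
  by move=> s; have [_ [/(_ (2 * d)%N)]] := Dg s.
pose L := \sum_s `|C1 s|.
have L0 : 0 <= L by apply: sumr_ge0.
have gL s x : `|'D_(delta_mx ord0 s) g x| <= L * lattice_weight x.
  apply: le_trans (gC1 s x) _; rewrite ler_wpM2r ?lattice_weight_ge0//.
  by apply: le_trans (ler_norm _) _; rewrite /L (bigD1 s)//= lerDl sumr_ge0.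
pose C := `|C0| + d%:R * (L * 4 ^+ d) + 1.
have C_gt0 : 0 < C.
  by rewrite ltr_wpDl// addr_ge0// !mulr_ge0// exprn_ge0.
have CC0 : `|C0| <= C by rewrite /C -addrA lerDl addr_ge0// !mulr_ge0// exprn_ge0.
have CL : d%:R * (L * 4 ^+ d) <= C.
  by rewrite /C -addrA addrCA lerDl addr_ge0.
have w0 := @lattice_weight_ge0 R d.
have gw x : (1 + `|x|) * `|g x| <= C * lattice_weight x.
  apply: (@le_trans _ _ (`|C0| * lattice_weight x)); last by rewrite ler_wpM2r.
  apply: (@le_trans _ _ (C0 * lattice_weight x)); last first.
    by rewrite ler_wpM2r// ler_norm.
  rewrite mulrC -ler_pdivlMr ?ltr_wpDr//.
  by have := gC0 x; rewrite exprSr invfM mulrA.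
exists C => //; split => // x y.
(* At distance at least 1 the triangle inequality suffices. Below 1, the mean value bound applies on
   a ball around [y], where all weights are within [4 ^+ d] of the one at [y]. *)
have [xy|xy] := leP 1 `|x - y|.
  rewrite mulr1 mulrDr (le_trans (ler_normB _ _))//.
  have gle z : `|g z| <= C * lattice_weight z.
    by apply: le_trans (gw z); rewrite mulrDl mul1r lerDl mulr_ge0.
  by rewrite lerD.
apply: (@le_trans _ _ (d%:R * (L * 4 ^+ d * lattice_weight y) * `|x - y|)).
  apply: partials_le => [s z|s z zy]; first by have [] := Dg s.
  apply: le_trans (gL _ _) _; rewrite -mulrA ler_wpM2l// lattice_weight_le2//.
  exact: le_trans zy (ltW xy).
rewrite mulrA mulrAC ler_pM ?mulr_ge0 ?exprn_ge0//.
  by rewrite ler_wpM2r.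
by rewrite lerDr.
Qed.

Lemma continuous_lipschitz (g : 'rV[R]_d -> R) (L : R) :
  (forall x y, `|g x - g y| <= L * `|x - y|) -> continuous g.
Proof.
move=> gL x; have F : Filter (nbhs x) by exact: nbhs_filter.
apply/(@cvgrPdist_le _ _ _ (nbhs x) F) => e e0.
have L1 : 0 < `|L| + 1 by rewrite ltr_wpDl.
near=> y; apply: le_trans (gL _ _) _.
apply: (@le_trans _ _ ((`|L| + 1) * `|x - y|)).
  by rewrite ler_wpM2r// (le_trans (ler_norm _))// lerDl.
rewrite -ler_pdivlMl//; near: y; apply: cvgr_dist_le => //.
by rewrite mulr_gt0// invr_gt0.
Unshelve. all: by end_near. Qed.

End smooth_decay.

(** * Localized functions and the vanishing moment *)

(** Replaces passages to the limit at rate [2 ^- m] by inequalities valid for every [m]. *)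
Lemma le0_geometric {R : realType} (a A : R) :
  (forall m, a <= A * 2 ^- m) -> a <= 0.
Proof.
move=> aA; rewrite leNgt; apply/negP => a0.
pose m := (Num.trunc (A / a)).+1; have := aA m.
have : A / a < m%:R by exact: truncnS_gt.
rewrite ltr_pdivrMr// => Am; rewrite ler_pdivlMr ?exprn_gt0//.
apply/negP; rewrite -ltNge (lt_le_trans Am)// mulrC ler_pM2l//.
by rewrite -natrX ler_nat ltnW// ltn_expl.
Qed.

Section wavelet_function.
Context {R : realType} {d : nat}.
Implicit Types (x y z : 'rV[R]_d) (k l : 'rV[int]_d) (g : 'rV[R]_d -> R).
Notation mu := (@lebesgue_rV R d).

(** The factor [1 + |x|] makes [g] integrable against functions of linear growth, such as Hoelder or
    Lipschitz increments. The increment bound carries the weights of both points so that it can be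
    summed over lattice translates. *)
Definition localized (C : R) g := [/\ 0 < C,
  forall x, (1 + `|x|) * `|g x| <= C * lattice_weight x &
  forall x y, `|g x - g y| <=
    C * Num.min 1 `|x - y| * (lattice_weight x + lattice_weight y)].

Section localized_theory.
Variables (C : R) (g : 'rV[R]_d -> R) (gC : localized C g).

Lemma localized_le x : `|g x| <= C * lattice_weight x.
Proof.
have [_ /(_ x) + _] := gC; apply: le_trans.
by rewrite mulrDl mul1r lerDl mulr_ge0.
Qed.

Lemma localized_bounded x : `|g x| <= C.
Proof.
have [C0 _ _] := gC; apply: le_trans (localized_le x) _.
by rewrite ler_piMr ?lattice_weight_le1// ltW.
Qed.

Lemma localized_lipschitz x y : `|g x - g y| <= 2 * C * `|x - y|.
Proof.
have [C0 _ /(_ x y)] := gC; move/le_trans; apply.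
rewrite [2 * C]mulrC -!mulrA ler_pM2l// [2 * _]mulrC.
apply: ler_pM; rewrite ?addr_ge0 ?lattice_weight_ge0//.
- by rewrite ge_min lexx orbT.
- by have := lattice_weight_le1 x; have := lattice_weight_le1 y; lra.
Qed.

Lemma measurable_localized : measurable_fun setT g.
Proof. by apply: measurable_continuous_rV; exact: continuous_lipschitz localized_lipschitz. Qed.

Lemma abs_sums_le_localized z :
  abs_sums_le (fun k => g (z - intv k)) (C * 16 ^+ d).
Proof.
have [C0 _ _] := gC.
move=> J; apply: le_trans (_ : \sum_(k <- J) C * lattice_weight (z - intv k) <= _).
  by apply: ler_sum => k _; exact: localized_le.
by rewrite -mulr_sumr ler_pM2l// sum_lattice_weight.
Qed.

Lemma integrable_localizedM (h : 'rV[R]_d -> R) (A : R) : 0 <= A ->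
  measurable_fun setT h -> (forall x, `|h x| <= A * (1 + `|x|)) ->
  mu.-integrable setT (EFin \o (fun x => h x * g x)) /\
  `|\int[mu]_x (h x * g x)| <= A * C * 16 ^+ d.
Proof.
move=> A0 mh hA; apply: integrable_decay.
  by apply: measurable_funM => //; exact: measurable_localized.
move=> x; rewrite normrM -mulrA; have [_ /(_ x) gx _] := gC.
apply: le_trans (_ : A * (1 + `|x|) * `|g x| <= _); first by rewrite ler_wpM2r.
by rewrite -mulrA ler_wpM2l.
Qed.

Lemma integrable_localized : mu.-integrable setT (EFin \o g).
Proof.
have [] := @integrable_localizedM (cst 1) 1 ler01; first exact: measurable_cst.
  by move=> x; rewrite normr1 mul1r lerDl.
by move=> + _; apply: eq_integrable => // x _ /=; rewrite mul1r.
Qed.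

(** Dyadic points are dense and [g] is Lipschitz. A dyadic centre is wanted because it equals
    [2 ^- j k] with an integral [k] at every level [j >= J], so the finer copies of the wavelet can
    be centred exactly there. *)
Lemma localized_dyadic_neq0 x : g x != 0 -> exists J k, g (2 ^- J *: intv k) != 0.
Proof.
move=> gx0; apply: contrapT => H; move: gx0; apply/negP; rewrite negbK.
rewrite -normr_le0; apply: (@le0_geometric _ _ (2 * C)) => m.
have gm : g (2 ^- m *: intv (floorv (2 ^+ m *: x))) = 0.
  by apply/eqP; apply: contrapT => /negP h; apply: H; exists m, (floorv (2 ^+ m *: x)).
have [C0 _ _] := gC.
rewrite -[g x]subr0 -gm; apply: le_trans (localized_lipschitz _ _) _.
by rewrite ler_pM2l ?mulr_gt0// dyadic_approx.
Qed.

Lemma measurable_dilation (h : 'rV[R]_d -> R) (a : R) z : measurable_fun setT h ->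
  measurable_fun setT (fun y => h (a *: y + z)).
Proof.
move=> mh; apply: (measurableT_comp mh).
by have := measurable_affine a (- z); under eq_fun do rewrite opprK.
Qed.

(* Rescaling by [2 ^ j] around a dyadic point [x0] where [g x0 != 0], the
   orthogonality relation becomes [\int g (x0 + 2 ^- j y) g y = 0], whose limit
   is [g x0 * \int g = 0]. *)
Lemma localized_vanishing_moment x :
  (forall j k, (0 < j)%N -> \int[mu]_x (g x * g (2 ^+ j *: x - intv k)) = 0) ->
  g x != 0 -> \int[mu]_x g x = 0.
Proof.
move=> orth /localized_dyadic_neq0[J [K gx0]]; set x0 := 2 ^- J *: intv K in gx0.
have [C0 _ _] := gC.
suff : `|g x0 * \int[mu]_x g x| <= 0.
  by rewrite normr_le0 mulf_eq0 (negbTE gx0)/= => /eqP.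
apply: (@le0_geometric _ _ (2 * C * C * 16 ^+ d)) => m.
(* The level exceeds [m], which gives the rate, and is positive, as [orth] requires; [k] keeps the
   centre at [x0]. *)
pose j := (J + m.+1)%N; pose k := 2 ^+ m.+1 *: K.
have j0 : (0 : R) < 2 ^+ j by rewrite exprn_gt0.
have x0E : 2 ^- j *: intv k = x0.
  by rewrite /x0 /k intv_scale scalerA /j exprD invfM -mulrA mulVf ?mulr1.
pose h y := g (2 ^- j *: y + x0).
have mh : measurable_fun setT h by exact: measurable_dilation measurable_localized.
have hC y : `|h y| <= C * (1 + `|y|).
  by apply: le_trans (localized_bounded _) _; rewrite ler_peMr ?lerDl// ltW.
have [ih _] := integrable_localizedM (ltW C0) mh hC.
have h0 : \int[mu]_y (h y * g y) = 0.
  rewrite (Rintegral_affine (intv k) j0 measurableT ih) preimage_setT.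
  rewrite -[RHS](mulr0 ((2 ^+ j) ^+ d)); congr (_ * _).
  rewrite -(orth j k) ?addn_gt0 ?orbT//; apply: eq_Rintegral => y _.
  by rewrite /h -{1}x0E scalerBr subrK scalerA mulVf ?gt_eqF// scale1r.
have B0 : 0 <= 2 * C * 2 ^- j by rewrite !mulr_ge0 ?invr_ge0 ?exprn_ge0// ltW.
have [||ihd hd] := @integrable_localizedM (fun y => g x0 - h y) _ B0.
- exact: measurable_funB.
- move=> y; apply: le_trans (localized_lipschitz _ _) _.
  rewrite opprD addrCA subrr addr0 normrN normrZ.
  rewrite ger0_norm ?invr_ge0 ?exprn_ge0// mulrA ler_wpM2l// lerDr.
  exact: ler01.
have -> : g x0 * \int[mu]_x g x = \int[mu]_y ((g x0 - h y) * g y).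
  under [RHS]eq_Rintegral do rewrite mulrBl.
  rewrite RintegralB//; last first.
    have := integrableZl measurableT (g x0) integrable_localized.
    by apply: eq_integrable => // y _.
  by rewrite h0 subr0 RintegralZl//; exact: integrable_localized.
apply: le_trans hd _; rewrite mulrAC -!mulrA !ler_pM2l//.
rewrite mulrCA [_ * C]mulrC mulrCA !ler_pM2l ?exprn_gt0//.
rewrite lef_pV2 ?posrE ?exprn_gt0// ler_eXn2l ?ltr1n//.
by rewrite /j addnS ltnW// ltnS leq_addl.
Qed.

End localized_theory.

(** * Nearest representatives on the torus *)

Lemma torus_dist_le x y : torus_dist x y <= `|x - y|.
Proof.
apply: ge_inf; first by exists 0 => _ [l _ <-].
by exists 0 => //; rewrite intv0 subr0.
Qed.

(** Rounding every coordinate of [x - y] to a nearest integer minimizes all coordinates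
    simultaneously, hence their maximum; the infimum is attained. *)
Lemma torus_dist_min x y : exists l,
  torus_dist x y = `|x - y - intv l| /\ `|x - y - intv l| <= 2^-1.
Proof.
pose t := x - y; pose l : 'rV[int]_d := \row_i Num.floor (t ord0 i + 2^-1).
have tl i : (l ord0 i)%:~R <= t ord0 i + 2^-1 < (l ord0 i)%:~R + 1.
  rewrite mxE floor_le/=.
  by have := floorD1_gt (t ord0 i + 2^-1); rewrite intrD.
have tl2 i : `|t ord0 i - (l ord0 i)%:~R| <= 2^-1.
  by rewrite ler_norml; have /andP[h1 h2] := tl i; apply/andP; split; lra.
exists l; rewrite -/t; split; last first.
  by apply: normr_le_coord => [|i]; rewrite ?invr_ge0// !mxE -/(t ord0 i); have := tl2 i; rewrite !mxE.
apply/eqP; rewrite eq_le; apply/andP; split.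
  by apply: ge_inf; [exists 0 => _ [m _ <-]|exists l].
apply: lb_le_inf; first by exists `|t - intv l|, l.
move=> _ [m _ <-]; apply: normr_le_coord => // i; rewrite -/t.
apply: le_trans (normr_coord_le _ i); rewrite !mxE -/(l ord0 i).
have [<-|ml] := eqVneq (l ord0 i) (m ord0 i); first by rewrite !mxE.
apply: (@le_trans _ _ 2^-1); first by have := tl2 i; rewrite !mxE.
(* Another integer is at distance at least 1 from the nearest one, hence at least [1 - 1/2] from the
   coordinate. *)
have : 1 <= `|(l ord0 i)%:~R - (m ord0 i)%:~R| :> R.
  by rewrite -intrB -intr_norm -[1]/(1%:~R) ler_int -gtz0_ge1 normr_gt0 subr_eq0.
have := tl2 i; set u := t ord0 i; set a : R := (l ord0 i)%:~R; set b : R := (m ord0 i)%:~R.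
have : `|a - b| <= `|u - a| + `|u - b|.
  by rewrite [X in _ <= X + _]distrC -[a - b](subrKA u); exact: ler_normD.
have -> : x ord0 i - y ord0 i = u by rewrite /u /t !mxE.
by lra.
Qed.

End wavelet_function.

(** * Periodized wavelets *)

Lemma sum_uniq_seq_le {R : realType} {I : choiceType} (u : I -> R) M (s : seq I) :
  abs_sums_le u M -> uniq s -> \sum_(i <- s) `|u i| <= M.
Proof.
move=> /(_ (seq_fset tt s)) + us; rewrite (perm_big _ (seq_fset_perm _ _)).
by rewrite undup_id.
Qed.

Definition level_range {d : nat} (j : nat) (k : 'rV[int]_d) :=
  [forall s, 0 <= k ord0 s < 2 ^+ j].

(** Coordinatewise uniqueness of Euclidean division by [2 ^+ j]. *)
Lemma level_range_inj {d : nat} j (k k' l l' : 'rV[int]_d) :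
  level_range j k -> level_range j k' ->
  k + 2 ^+ j *: l = k' + 2 ^+ j *: l' -> (k, l) = (k', l').
Proof.
move=> /forallP kj /forallP k'j /rowP e.
have kk' : k = k'.
  apply/rowP => s; have := e s; rewrite !mxE => /(congr1 (modz^~ (2 ^+ j))).
  rewrite [2 ^+ j * l 0 s]mulrC [2 ^+ j * l' 0 s]mulrC [k 0 s + _]addrC.
  by rewrite [k' 0 s + _]addrC !modzMDl (modz_small (kj s)) (modz_small (k'j s)).
rewrite -kk'; congr pair; apply/rowP => s; have := e s.
by rewrite -kk' !mxE => /addrI/mulfI; apply; rewrite expf_neq0.
Qed.

Section periodized.
Context {R : realType} {d : nat}.
Implicit Types (x y z : 'rV[R]_d) (k l m : 'rV[int]_d) (g : 'rV[R]_d -> R) (j : nat).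
Notation mu := (@lebesgue_rV R d).

(** The classes modulo [2 ^+ j] of the positions in [s] are disjoint, so their sums share the single
    bound [M] of the whole lattice family. *)
Lemma level_sum_le (u : 'rV[int]_d -> R) (M : R) j (s : seq 'rV[int]_d) :
  abs_sums_le u M -> uniq s -> all (level_range j) s ->
  \sum_(k <- s) `|summability.sum (fun l => u (k + 2 ^+ j *: l))| <= M.
Proof.
move=> uM us sj; have F := @summability.totally_filter 'rV[int]_d.
have uk k : abs_sums_le (fun l => u (k + 2 ^+ j *: l)) M.
  apply: (abs_sums_le_comp (h := fun l => k + 2 ^+ j *: l)) uM.
  move=> l l' /addrI/rowP e; apply/rowP => i.
  by have := e i; rewrite !mxE => /mulfI; apply; rewrite expf_neq0.
(* Truncating all inner sums to the same finite set makes the left-hand side a limit along one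
   net. *)
pose S (L : {fset 'rV[int]_d}) :=
  \sum_(k <- s) `|summability.partial_sum (fun l => u (k + 2 ^+ j *: l)) L|.
have cS : S @ summability.totally -->
    \sum_(k <- s) `|summability.sum (fun l => u (k + 2 ^+ j *: l))|.
  rewrite /S; elim: (s) => [|k t IH].
    by under eq_fun do rewrite big_nil; rewrite big_nil; exact: cvg_cst.
  under eq_fun do rewrite big_cons; rewrite big_cons.
  by apply: cvgD IH; apply: cvg_norm; exact: cvg_partial_sum (uk k).
have := cvgP _ cS; rewrite -(cvg_lim (@Rhausdorff R) cS) => cvS.
apply: limr_le => //; apply: nearW => L.
apply: (@le_trans _ _ (\sum_(k <- s) \sum_(l <- L) `|u (k + 2 ^+ j *: l)|)).
  by apply: ler_sum => k _; rewrite partial_sumE; exact: ler_norm_sum.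
have -> : \sum_(k <- s) \sum_(l <- L) `|u (k + 2 ^+ j *: l)| =
    \sum_(m <- [seq k + 2 ^+ j *: l | k <- s, l <- L]) `|u m|.
  by rewrite big_allpairs_dep.
apply: sum_uniq_seq_le => //; apply: allpairs_uniq => //; first exact: fset_uniq.
move=> [k l] [k' l'] /allpairsP[[? ?] /= [ks _ [-> ->]]].
move=> /allpairsP[[? ?] /= [k's _ [-> ->]]] /=.
by apply: level_range_inj; exact: (allP sj).
Qed.

Definition periodized g j k x : R :=
  summability.sum (fun l => g (2 ^+ j *: (x - intv l) - intv k)).

(** Turns the periodization into a sum over the class of [k] modulo [2 ^+ j], the shape required by
    [level_sum_le]. *)
Lemma dilation_shift j x k l : 2 ^+ j *: (x - intv l) - intv k =
  2 ^+ j *: x - intv (k + 2 ^+ j *: l) :> 'rV[R]_d.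
Proof. by rewrite intvD intv_scale scalerBr opprD addrA addrAC. Qed.

Section localized_periodized.
Variables (C : R) (g : 'rV[R]_d -> R) (gC : localized C g).

Lemma abs_sums_le_periodized j k x :
  abs_sums_le (fun l => g (2 ^+ j *: (x - intv l) - intv k)) (C * 16 ^+ d).
Proof.
under eq_fun do rewrite dilation_shift.
apply: (abs_sums_le_comp (u := fun m => g (2 ^+ j *: x - intv m))
  (h := fun l => k + 2 ^+ j *: l)); last exact: abs_sums_le_localized.
move=> l l' /addrI/rowP e; apply/rowP => i.
by have := e i; rewrite !mxE => /mulfI; apply; rewrite expf_neq0.
Qed.

Lemma periodized_periodic j k x l :
  periodized g j k (x + intv l) = periodized g j k x.
Proof.
have := sum_unconditional_bij (addrNK l) (addrK l) (abs_sums_le_periodized j k x).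
rewrite -/(periodized g j k x) => <-; congr (summability.sum _).
by apply/funext => m /=; rewrite intvB opprB addrA.
Qed.

Lemma periodized_level_sum_le j (s : seq 'rV[int]_d) x :
  uniq s -> all (level_range j) s ->
  \sum_(k <- s) `|periodized g j k x| <= C * 16 ^+ d.
Proof.
move=> us sj; rewrite /periodized; under eq_bigr do under eq_fun do rewrite dilation_shift.
exact: (level_sum_le (u := fun m => g (2 ^+ j *: x - intv m)) (abs_sums_le_localized gC _)).
Qed.

(** The minimum factors out of the increments because dilation multiplies the distance by [2 ^+ j];
    the factor 2 counts the lattice sums around the two points. *)
Lemma periodizedB_level_sum_le j (s : seq 'rV[int]_d) x y :
  uniq s -> all (level_range j) s ->
  \sum_(k <- s) `|periodized g j k x - periodized g j k y| <=
    2 * C * 16 ^+ d * Num.min 1 (2 ^+ j * `|x - y|).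
Proof.
move=> us sj; have [C0 _ gB] := gC.
pose u m := g (2 ^+ j *: x - intv m) - g (2 ^+ j *: y - intv m).
have -> : \sum_(k <- s) `|periodized g j k x - periodized g j k y| =
    \sum_(k <- s) `|summability.sum (fun l => u (k + 2 ^+ j *: l))|.
  apply: eq_bigr => k _; rewrite /periodized -(sum_unconditionalB
    (abs_sums_le_periodized j k x) (abs_sums_le_periodized j k y)).
  by under eq_fun do rewrite !dilation_shift.
apply: level_sum_le => // J; set m0 := Num.min 1 _.
have m00 : 0 <= m0 by rewrite le_min ler01 mulr_ge0.
apply: (@le_trans _ _ (\sum_(k <- J) C * m0 *
   (lattice_weight (2 ^+ j *: x - intv k) + lattice_weight (2 ^+ j *: y - intv k)))).
  apply: ler_sum => k _; apply: le_trans (gB _ _) _.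
  rewrite (_ : _ - _ - _ = 2 ^+ j *: (x - y)); last first.
    by rewrite opprB addrA subrK scalerBr.
  by rewrite normrZ ger0_norm.
have -> : 2 * C * 16 ^+ d * m0 = C * m0 * (16 ^+ d + 16 ^+ d) by ring.
rewrite -mulr_sumr big_split/= ler_wpM2l ?mulr_ge0 ?(ltW C0)//.
by rewrite lerD// sum_lattice_weight.
Qed.

(* Unfolding the periodization and rescaling, the coefficient becomes
   [\int (f (2 ^- j (y + k)) - f (2 ^- j k)) * g y], because [\int g = 0]. *)
Lemma periodized_coef_le (f : 'rV[R]_d -> R) (M Cf alpha : R) j k :
  measurable_fun setT f -> (forall x l, f (x - intv l) = f x) ->
  (forall x, `|f x| <= M) -> 0 <= Cf -> 0 <= alpha <= 1 ->
  (forall x y, `|f x - f y| <= Cf * `|x - y| `^ alpha) ->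
  \int[mu]_x g x = 0 ->
  `|2 ^+ (d * j) * \int[mu]_(x in unit_cube) (f x * periodized g j k x)| <=
    Cf * C * 16 ^+ d * (2 ^- j) `^ alpha.
Proof.
move=> mf fper fM Cf0 /andP[a0 a1] fH g0; have [C0 _ _] := gC.
have M0 : 0 <= M := le_trans (normr_ge0 _) (fM 0).
have j0 : (0 : R) < 2 ^+ j by rewrite exprn_gt0.
pose h y := f (2 ^- j *: y + 2 ^- j *: intv k).
have mh : measurable_fun setT h by exact: measurable_dilation.
have hM y : `|h y| <= M * (1 + `|y|).
  by apply: le_trans (fM _) _; rewrite ler_peMr// lerDl.
have [ih _] := integrable_localizedM gC M0 mh hM.
pose F x := f x * g (2 ^+ j *: x - intv k).
have FE x : h (2 ^+ j *: x - intv k) * g (2 ^+ j *: x - intv k) = F x.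
  by rewrite /h /F scalerBr subrK scalerA mulVf ?gt_eqF// scale1r.
have iF : mu.-integrable setT (EFin \o F).
  have := integrable_affine (intv k) j0 ih.
  by apply: eq_integrable => // x _ /=; rewrite FE.
have FMx x : abs_sums_le (fun l => F (x - intv l)) (M * (C * 16 ^+ d)).
  move=> J; rewrite /F; apply: (@le_trans _ _
    (\sum_(l <- J) M * `|g (2 ^+ j *: (x - intv l) - intv k)|)).
    by apply: ler_sum => l _; rewrite normrM ler_wpM2r.
  by rewrite -mulr_sumr ler_wpM2l// abs_sums_le_periodized.
have -> : \int[mu]_(x in unit_cube) (f x * periodized g j k x) = \int[mu]_x F x.
  rewrite -(Rintegral_periodization iF FMx); apply: eq_Rintegral => x _.
  rewrite /periodized -(sum_unconditionalZ (f x) (abs_sums_le_periodized j k x)).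
  by congr summability.sum; apply/funext => l; rewrite /F fper.
(* The normalization of the coefficients is exactly the Jacobian of [x |-> 2 ^ j x - k]. *)
have -> : 2 ^+ (d * j) * \int[mu]_x F x = \int[mu]_y (h y * g y).
  rewrite (Rintegral_affine (intv k) j0 measurableT ih) preimage_setT.
  rewrite mulnC exprM; congr (_ * _); apply: eq_Rintegral => x _.
  by rewrite FE.
have A0 : 0 <= Cf * (2 ^- j) `^ alpha by rewrite mulr_ge0 ?powR_ge0.
have [||ihB hB] := @integrable_localizedM _ _ _ _ gC (fun y => h y - f (2 ^- j *: intv k)) _ A0.
- by apply: measurable_funB.
- move=> y; apply: le_trans (fH _ _) _; rewrite addrK normrZ.
  rewrite ger0_norm ?invr_ge0 ?exprn_ge0// powRM ?invr_ge0 ?exprn_ge0//.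
  rewrite -mulrA ler_wpM2l// ler_wpM2l ?powR_ge0//.
  (* As [alpha <= 1] and the base is at least 1, the Hoelder increment grows at most linearly, which
     [integrable_localizedM] tolerates. *)
  apply: (@le_trans _ _ ((1 + `|y|) `^ alpha)).
    by apply: ge0_ler_powR; rewrite ?nnegrE ?addr_ge0// lerDr.
  rewrite -[leRHS]powRr1 ?addr_ge0//; apply: ler_powR => //.
  by rewrite lerDl.
have -> : \int[mu]_y (h y * g y) = \int[mu]_y ((h y - f (2 ^- j *: intv k)) * g y).
  under [RHS]eq_Rintegral do rewrite mulrBl.
  have ig := integrable_localized gC.
  rewrite RintegralB//; last first.
    have := integrableZl measurableT (f (2 ^- j *: intv k)) ig.
    by apply: eq_integrable => // y _.
  by rewrite RintegralZl// g0 mulr0 subr0.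
suff <- : Cf * (2 ^- j) `^ alpha * C * 16 ^+ d = Cf * C * 16 ^+ d * (2 ^- j) `^ alpha by [].
by ring.
Qed.

End localized_periodized.

Lemma localized_mono (C C' : R) g : C <= C' -> localized C g -> localized C' g.
Proof.
move=> CC' [C0 g1 g2]; split; first exact: lt_le_trans CC'.
  by move=> x; apply: le_trans (g1 x) _; rewrite ler_wpM2r ?lattice_weight_ge0.
move=> x y; apply: le_trans (g2 x y) _.
rewrite -!mulrA ler_wpM2r// mulr_ge0 ?addr_ge0 ?lattice_weight_ge0//.
Qed.

Lemma wavelet_localized (phi : 'rV[R]_d -> R) Psi :
  orthonormal_wavelet_basis phi Psi 1 ->
  exists C, forall i, localized C (Psi i).
Proof.
move=> [_ Psi_s _].
have /choice[C PC] : forall i, exists C, localized C (Psi i).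
  by move=> i; have [C C0 [h1 h2]] := smooth_fast_decay1P (Psi_s i); exists C.
exists (\sum_i `|C i|) => i; apply: localized_mono (PC i).
by apply: le_trans (ler_norm _) _; rewrite (bigD1 i)//= lerDl sumr_ge0.
Qed.

(** Orthogonality of the wavelet at level 0 to its copies at all finer levels feeds the vanishing
    moment lemma; its unit norm supplies a point where it is nonzero. *)
Lemma wavelet_integral0 (phi : 'rV[R]_d -> R) Psi i :
  orthonormal_wavelet_basis phi Psi 1 -> \int[mu]_x Psi i x = 0.
Proof.
move=> W; have [C /(_ i) PC] := wavelet_localized W; have [_ _ [_ orth _]] := W.
have [C0 _ _] := PC.
have mP := measurable_localized PC.
have [x Px] : exists x, Psi i x != 0.
  apply: contrapT => H.
  have := orth (inr (i, 0%N, 0)) (inr (i, 0%N, 0)); rewrite eqxx.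
  rewrite (@eq_Rintegral _ _ _ _ _ (cst 0)); last first.
    move=> x _ /=; apply/eqP; rewrite !mulf_eq0.
    suff -> : Psi i (2 ^+ 0 *: x - intv 0) == 0 by rewrite !orbT.
    by apply/negPn/negP => h; apply: H; eexists; exact: h.
  rewrite Rintegral_cst// mul0r => /eqP; rewrite eq_sym; apply/negP.
  exact: oner_neq0.
apply: (localized_vanishing_moment PC (x := x)) => // j k j0.
pose c : R := 2 `^ ((d * j)%:R / 2).
have c0 : c != 0 by rewrite gt_eqF// powR_gt0.
have := orth (inr (i, 0%N, 0)) (inr (i, j, k)).
rewrite (_ : _ == _ = false); last first.
  by apply/negP => /eqP[/esym e]; move: j0; rewrite e.
rewrite /wavelet_family (@eq_Rintegral _ _ _ _ _
  (fun x => c * (Psi i x * Psi i (2 ^+ j *: x - intv k)))); last first.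
  move=> y _; rewrite muln0 mul0r powRr0 mul1r expr0 scale1r intv0 subr0.
  by rewrite -/c mulrCA.
rewrite RintegralZl//; first by move=> /eqP; rewrite mulf_eq0 (negbTE c0)/= => /eqP.
have mT : measurable_fun setT (fun y => Psi i (2 ^+ j *: y - intv k)).
  exact: measurable_dilation.
have PT y : `|Psi i (2 ^+ j *: y - intv k)| <= C * (1 + `|y|).
  by apply: le_trans (localized_bounded PC _) _; rewrite ler_peMr ?lerDl// ltW.
have [+ _] := integrable_localizedM PC (ltW C0) mT PT.
by apply: eq_integrable => // y _ /=; rewrite mulrC.
Qed.

End periodized.

(** * Sums over dyadic scales *)

Section dyadic_scales.
Context {R : realType}.

(** Lets a factor [(1 + s) ^ p] be absorbed by an exponential of arbitrarily small rate. Dividing by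
    [p + 1] keeps the choice of [e] valid at [p = 0]. *)
Lemma log_le_linear (p eta : R) : 0 <= p -> 0 < eta ->
  exists K, forall s, 0 <= s -> p * ln (1 + s) <= K + eta * s.
Proof.
move=> p0 eta0; pose e := eta / (p + 1).
have p1 : 0 < p + 1 by rewrite ltr_wpDl.
have e0 : 0 < e by rewrite divr_gt0.
exists (p * e - p * ln e) => s s0.
have s1 : 0 < 1 + s by rewrite ltr_pwDl.
have h : ln (1 + s) <= e * (1 + s) - ln e.
  have -> : ln (1 + s) = ln (e * (1 + s)) - ln e.
    by rewrite lnM ?posrE// addrAC subrr add0r.
  rewrite lerD2r -[leRHS]expRK ler_ln ?posrE ?(mulr_gt0 e0 s1) ?expR_gt0//.
  by apply: le_trans (expR_ge1Dx _); rewrite lerDr.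
have pe : p * e <= eta.
  rewrite /e mulrA ler_pdivrMr// mulrC ler_pM2l// lerDl; exact: ler01.
have := ler_wpM2l p0 h; have := ler_wpM2r s0 pe; nra.
Qed.

Lemma sum_geometric_le (q : R) m : 0 <= q < 1 ->
  \sum_(i < m) q ^+ i <= (1 - q)^-1.
Proof.
move=> /andP[q0 q1]; rewrite -[leRHS]mul1r ler_pdivlMr ?subr_gt0// mulrC.
have -> : (1 - q) * (\sum_(i < m) q ^+ i) = 1 - q ^+ m.
  by rewrite -opprB mulNr -subrX1 opprB.
by rewrite gerBl exprn_ge0.
Qed.

Lemma sum_geometric_dist_le (q : R) m n0 : 0 <= q < 1 ->
  \sum_(i < m) q ^+ `|i%:Z - n0%:Z| <= 2 * (1 - q)^-1.
Proof.
move=> /[dup] q01 /andP[q0 q1].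
apply: (@le_trans _ _ (\sum_(i < n0 + m) q ^+ `|i%:Z - n0%:Z|)).
  rewrite addnC big_split_ord/= lerDl.
  by apply: sumr_ge0 => i _; exact: exprn_ge0.
rewrite big_split_ord/= mulr_natl mulr2n; apply: lerD.
  apply: le_trans (sum_geometric_le n0 q01).
  rewrite (reindex_inj rev_ord_inj)/=; apply: ler_sum => i _.
  have -> : `|(n0 - i.+1)%N%:Z - n0%:Z|%N = i.+1.
    by have := ltn_ord i; lia.
  by rewrite exprS ler_piMl ?exprn_ge0// ltW.
apply: le_trans (sum_geometric_le m q01); apply: ler_sum => i _.
by have -> : `|(n0 + i)%N%:Z - n0%:Z|%N = i by lia.
Qed.

Lemma expR_ln2M (n : nat) : expR (n%:R * ln 2) = 2 ^+ n :> R.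
Proof. by rewrite expRM_natl lnK ?posrE. Qed.

Lemma powR_dyadic (n : nat) (a : R) : (2 ^- n) `^ a = expR (- (a * (n%:R * ln 2))).
Proof.
by rewrite -expR_ln2M -expRN /powR gt_eqF ?expR_gt0// expRK mulrN.
Qed.

(* With [t = ln (2 ^ j * delta)], the [j]-th term is at most
   [delta `^ alpha * (1 + j) `^ p * exp (- beta * |t|)] for
   [beta = min alpha (1 - alpha)], so the sum concentrates on the scales with
   [2 ^ j] close to [1 / delta]. *)
Lemma sum_scales_le (alpha p : R) : 0 < alpha < 1 -> 0 <= p ->
  exists2 C, 0 < C & forall delta m, 0 < delta <= 2^-1 ->
    \sum_(j < m) (2 ^- j) `^ alpha * (1 + j%:R) `^ p * Num.min 1 (2 ^+ j * delta) <=
    C * delta `^ alpha * `|ln delta| `^ p.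
Proof.
move=> /andP[a0 a1] p0; pose c : R := ln 2.
have c0 : 0 < c by rewrite ln_gt0// ltr1n.
pose b := Num.min alpha (1 - alpha).
have b0 : 0 < b by rewrite lt_min a0 subr_gt0 a1.
have ba : b <= alpha by rewrite ge_min lexx.
have ba1 : b <= 1 - alpha by rewrite ge_min lexx orbT.
(* Half of the decay rate [b * c] is spent on absorbing [(1 + s) ^ p]; the other half becomes the
   ratio [q]. *)
have eta0 : 0 < b * c / 2 by rewrite divr_gt0// mulr_gt0.
have [K Kp] := log_le_linear p0 eta0.
pose q := expR (- (b * c / 2)).
have q01 : 0 <= q < 1 by rewrite expR_ge0 expR_lt1 oppr_lt0.
(* [(2 / c) ^ p] converts [2 * L] into [|ln delta|], [expR K] comes from the absorbed logarithm,
   [expR (b * c / 2)] from replacing [L] by its integer part, and the rest is the two-sided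
   geometric series. *)
pose C := (2 / c) `^ p * (expR (K + b * c / 2) * (2 * (1 - q)^-1)).
have C0 : 0 < C.
  have /andP[_ q1] := q01.
  by rewrite !mulr_gt0 ?powR_gt0 ?expR_gt0 ?divr_gt0 ?invr_gt0 ?subr_gt0.
exists C => // delta m /andP[d0 d2].
(* The critical scale: [2 ^ L = 1 / delta]. The assumption [delta <= 1/2] gives [1 <= L]. *)
pose L := - ln delta / c.
have lnd : ln delta <= - c.
  rewrite -[- c]/(- ln 2) -lnV ?posrE// ler_ln ?posrE//.
have L1 : 1 <= L by rewrite /L ler_pdivlMr// mul1r lerNr.
have L0 : 0 <= L by apply: le_trans L1.
have Lc : L * c = - ln delta by rewrite /L divfK// gt_eqF.
pose n0 := Num.trunc L.
have n0L : n0%:R <= L < n0.+1%:R.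
  by rewrite truncn_itv// (le_trans ler01).
have term (j : nat) : (2 ^- j) `^ alpha * (1 + j%:R) `^ p *
      Num.min 1 (2 ^+ j * delta) <=
    delta `^ alpha * `|ln delta| `^ p * (2 / c) `^ p * expR (K + b * c / 2) *
    q ^+ `|j%:Z - n0%:Z|.
  pose s := `|j%:R - L|.
  have s0 : 0 <= s by exact: normr_ge0.
  (* With [t = c (j - L)] the minimum is [min(1, e ^ t)]: use 1 and [b <= alpha] when [t >= 0], and
     [e ^ t] and [b <= 1 - alpha] when [t < 0]. *)
  have minE : Num.min 1 (2 ^+ j * delta) <= expR (alpha * (c * (j%:R - L)) - b * c * s).
    have e2 : 2 ^+ j * delta = expR (c * (j%:R - L)).
      rewrite -expR_ln2M -/c -[delta in LHS]lnK ?posrE// -expRD; congr expR.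
      by rewrite -[ln delta]opprK -Lc; ring.
    have [jL|jL] := leP L j%:R.
      apply: (@le_trans _ _ 1); first by rewrite ge_min lexx.
      have t0 : 0 <= c * (j%:R - L) by rewrite mulr_ge0 ?subr_ge0// ltW.
      rewrite -[leLHS]expR0 ler_expR /s ger0_norm ?subr_ge0//.
      by have := ler_wpM2r t0 ba; nra.
    apply: (@le_trans _ _ (2 ^+ j * delta)); first by rewrite ge_min lexx orbT.
    have t0 : 0 <= c * (L - j%:R) by rewrite mulr_ge0 ?subr_ge0// ltW.
    rewrite e2 ler_expR /s ltr0_norm ?subr_lt0//.
    by have := ler_wpM2r t0 ba1; nra.
  (* Since [1 <= L], [1 + j <= 1 + L + s <= 2 L (1 + s)]. *)
  have powE : (1 + j%:R) `^ p <= `|ln delta| `^ p * (2 / c) `^ p * expR (K + b * c / 2 * s).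
    have -> : `|ln delta| `^ p * (2 / c) `^ p = (2 * L) `^ p.
      rewrite -powRM ?normr_ge0// ?divr_ge0//; last exact: ltW.
      congr (_ `^ _); rewrite ler0_norm; last by rewrite (le_trans lnd)// oppr_le0 ltW.
      by rewrite -Lc; field; rewrite gt_eqF.
    apply: (@le_trans _ _ (((2 * L) * (1 + s)) `^ p)).
      apply: ge0_ler_powR; rewrite ?nnegrE ?addr_ge0//.
        by rewrite mulr_ge0 ?(addr_ge0 ler01 s0)// mulr_ge0.
      have : j%:R <= L + s.
        by rewrite -[j%:R](subrK L) addrC lerD2l ler_norm.
      by have := L1; nra.
    rewrite (powRM p (mulr_ge0 (ler0n _ 2) L0) (addr_ge0 ler01 s0)).
    apply: ler_wpM2l; first exact: powR_ge0.
    by rewrite /powR gt_eqF ?ltr_wpDr// ler_expR Kp.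
  have qE : expR (- (b * c / 2 * s)) <= expR (b * c / 2) * q ^+ `|j%:Z - n0%:Z|.
    rewrite /q -expRM_natl -expRD ler_expR.
    have : (`|j%:Z - n0%:Z|%N)%:R - 1 <= s.
      have -> : (`|j%:Z - n0%:Z|%N)%:R = `|j%:R - n0%:R| :> R.
        by rewrite natr_absz intr_norm intrB.
      have /andP[h1 h2] := n0L.
      rewrite lerBlDr; apply: (@le_trans _ _ (s + `|L - n0%:R|)).
        have -> : j%:R - n0%:R = (j%:R - L) + (L - n0%:R) :> R by rewrite addrA subrK.
        exact: ler_normD.
      rewrite lerD2l ger0_norm ?subr_ge0// lerBlDl; apply: le_trans (ltW h2) _.
      by rewrite -natr1.
    by have := eta0; move: (b * c / 2) (_%:R) => u v; nra.
  rewrite powR_dyadic -/c.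
  apply: (@le_trans _ _ (expR (- (alpha * (j%:R * c))) *
     (`|ln delta| `^ p * (2 / c) `^ p * expR (K + b * c / 2 * s)) *
     expR (alpha * (c * (j%:R - L)) - b * c * s))).
    apply: ler_pM => //; rewrite ?mulr_ge0 ?expR_ge0 ?powR_ge0//.
      by rewrite le_min ler01 mulr_ge0// ltW.
    by rewrite ler_wpM2l ?expR_ge0.
  have dE : delta `^ alpha = expR (- (alpha * (L * c))).
    by rewrite /powR gt_eqF// Lc mulrN opprK.
  set D := `|ln delta| `^ p * _.
  have D0 : 0 <= D by rewrite mulr_ge0 ?powR_ge0.
  rewrite [leLHS](_ : _ = D * (expR (- (alpha * (L * c))) * expR K * expR (- (b * c / 2 * s)))).
    rewrite [leRHS](_ : _ = D * (expR (- (alpha * (L * c))) * expR K *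
        (expR (b * c / 2) * q ^+ `|j%:Z - n0%:Z|))).
      by rewrite ler_wpM2l// ler_wpM2l// mulr_ge0 ?expR_ge0.
    have shuffle (u v w z t : R) : u * v * (w * z) * t = v * (u * w * (z * t)) by ring.
    by rewrite dE expRD -(mulrA _ (`|ln delta| `^ p)) -/D shuffle.
  have shuffle (u v w z : R) : u * (v * w) * z = v * (u * w * z) by ring.
  rewrite shuffle -!expRD; congr (_ * expR _).
  by field.
apply: (@le_trans _ _ (\sum_(j < m) delta `^ alpha * `|ln delta| `^ p * (2 / c) `^ p *
    expR (K + b * c / 2) * q ^+ `|j%:Z - n0%:Z|)).
  by apply: ler_sum => j _; exact: term.
rewrite -mulr_sumr.
have -> : C * delta `^ alpha * `|ln delta| `^ p = delta `^ alpha * `|ln delta| `^ p *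
  (2 / c) `^ p * expR (K + b * c / 2) * (2 * (1 - q)^-1) by rewrite /C; ring.
by rewrite ler_wpM2l ?sum_geometric_dist_le// !mulr_ge0 ?powR_ge0 ?expR_ge0.
Qed.

Lemma sum_scales_bounded (alpha p : R) : 0 < alpha -> 0 <= p ->
  exists C, forall m, \sum_(j < m) (2 ^- j) `^ alpha * (1 + j%:R) `^ p <= C.
Proof.
move=> a0 p0; pose c : R := ln 2.
have c0 : 0 < c by rewrite ln_gt0// ltr1n.
have eta0 : 0 < alpha * c / 2 by rewrite divr_gt0// mulr_gt0.
have [K Kp] := log_le_linear p0 eta0.
pose q := expR (- (alpha * c / 2)).
have q01 : 0 <= q < 1 by rewrite expR_ge0 expR_lt1 oppr_lt0.
exists (expR K * (1 - q)^-1) => m.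
apply: (@le_trans _ _ (\sum_(j < m) expR K * q ^+ j)); last first.
  by rewrite -mulr_sumr ler_wpM2l ?expR_ge0 ?sum_geometric_le.
apply: ler_sum => j _; rewrite powR_dyadic -/c.
rewrite /powR gt_eqF ?ltr_wpDr// /q -expRM_natl -!expRD ler_expR.
by have := Kp j%:R (ler0n _ _); move: (ln _) => x; nra.
Qed.

End dyadic_scales.

(** * Random coefficients *)

Section levels.
Context {R : realType} {d : nat}.
Notation D := (2 ^ d).-1.

(** Reduces a sum over triples to a series over levels by grouping [J] along [(i, j)]. The cutoff
    [m] depends on [J], so it is used with bounds on the series that are uniform in [m]. *)
Lemma level_family_le (a : wavelet_index d -> R)
    (w : 'I_D -> nat -> 'rV[int]_d -> R) (A V : nat -> R) :
  (forall n, `|a n| <= A (val n).1.2) -> (forall j, 0 <= A j) ->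
  (forall i j s, uniq s -> all (level_range j) s ->
    \sum_(k <- s) `|w i j k| <= V j) ->
  forall J : {fset wavelet_index d}, exists m,
    \sum_(n <- J) `|a n * w (val n).1.1 (val n).1.2 (val n).2| <=
    D%:R * \sum_(j < m) A j * V j.
Proof.
move=> aA A0 wV J; pose m := (\max_(n <- J) (val n).1.2)%N.
have nm (n : wavelet_index d) : n \in J -> ((val n).1.2 < m.+1)%N.
  by move=> nJ; rewrite ltnS; exact: (@leq_bigmax_seq _ (enum_fset J) xpredT
    (fun n : wavelet_index d => (val n).1.2)).
exists m.+1.
pose p (n : wavelet_index d) : 'I_D * 'I_m.+1 := ((val n).1.1, inord (val n).1.2).
rewrite (partition_big p xpredT)//=.
rewrite -(pair_bigA _ (fun i j => \sum_(n <- J | p n == (i, j))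
  `|a n * w (val n).1.1 (val n).1.2 (val n).2|))/=.
have -> : D%:R * \sum_(j < m.+1) A j * V j =
    \sum_(i < D) \sum_(j < m.+1) A j * V j.
  by rewrite sumr_const card_ord mulr_natl.
apply: ler_sum => i _; apply: ler_sum => j _.
have pE (n : wavelet_index d) : n \in J -> p n == (i, j) -> (val n).1 = (i, j : nat).
  by move=> nJ /eqP[<- <-]; rewrite inordK ?nm// -surjective_pairing.
(* The positions occurring in one group; they are distinct because [i] and [j] are fixed there. *)
pose s := [seq (val n).2 | n <- [seq n <- J | p n == (i, j)]].
apply: (@le_trans _ _ (\sum_(k <- s) A j * `|w i j k|)).
  rewrite big_map big_filter big_seq_cond [leRHS]big_seq_cond.
  apply: ler_sum => n /andP[nJ /(pE n nJ) e].
  by rewrite normrM e/= ler_wpM2r//; have := aA n; rewrite e.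
rewrite -mulr_sumr ler_wpM2l//; apply: wV.
  rewrite map_inj_in_uniq ?filter_uniq ?fset_uniq// => n n'.
  rewrite !mem_filter => /andP[/pE pn /pn e] /andP[/pE pn' /pn' e'] e2.
  by apply: val_inj; rewrite [val n]surjective_pairing [val n']surjective_pairing e e' e2.
apply/allP => k /mapP[n]; rewrite mem_filter => /andP[/pE pn /pn e] ->.
by have := valP n; rewrite /level_range e.
Qed.

Lemma size_level_range j (s : seq 'rV[int]_d) :
  uniq s -> all (level_range j) s -> (size s <= (2 ^ j) ^ d)%N.
Proof.
move=> us /allP sj.
have q0 : ((2 ^ j).-1.+1 = 2 ^ j)%N by rewrite prednK// expn_gt0.
pose c (k : 'rV[int]_d) : {ffun 'I_d -> 'I_(2 ^ j).-1.+1} :=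
  [ffun r => inord `|k ord0 r|].
have cI : {in s &, injective c}.
  move=> k k' /sj/forallP kj /sj/forallP k'j /ffunP e; apply/rowP => r.
  have := e r; rewrite !ffunE => /(congr1 (@nat_of_ord _)).
  have kE (l : 'rV[int]_d) : 0 <= l ord0 r < 2 ^+ j ->
      (`|l ord0 r| < (2 ^ j).-1.+1)%N /\ l ord0 r = `|l ord0 r|%N.
    move=> /andP[l0 lj]; rewrite gez0_abs//; split=> //.
    by rewrite q0 -ltz_nat gez0_abs// -natz natrX.
  have [h1 h1'] := kE _ (kj r); have [h2 h2'] := kE _ (k'j r).
  by rewrite !inordK// => e'; rewrite [LHS]h1' [RHS]h2' e'.
rewrite -(size_map c); have := max_card (mem (map c s)).
rewrite (card_uniqP _) ?map_inj_in_uniq//.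
by move=> /leq_trans; apply; rewrite card_ffun !card_ord q0.
Qed.

End levels.

(** * Almost sure growth of the random coefficients *)

Section borel_cantelli.
Context {dO} {Omega : measurableType dO} {R : realType}.
Variable P : probability Omega R.

(** Borel-Cantelli transported along the enumeration of [I], with the convergence of the series
    expressed by bounded finite sums. *)
Lemma ae_finitely_many {I : countType} (E : I -> set Omega) (M : R) :
  (forall n, measurable (E n)) ->
  (forall J : {fset I}, (\sum_(n <- J) P (E n) <= M%:E)%E) ->
  {ae P, forall omega, exists J : {fset I}, forall n, n \notin J -> ~ E n omega}.
Proof.
move=> mE EM; pose F i := oapp E set0 (pickle_inv i).
have mF i : measurable (F i) by rewrite /F; case: pickle_inv => [n|]/=.
have PF i : P (F i) = oapp (fun n => P (E n)) 0%E (pickle_inv i).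
  by rewrite /F; case: pickle_inv => //=; exact: measure0.
exists (lim_sup_set F); split.
- by apply: bigcap_measurable => // n _; exact: bigcup_measurable.
- apply: lim_sup_set_cvg0 => //; apply: le_lt_trans (ltry M).
  apply: lime_le; first exact: is_cvg_nneseries.
  apply: nearW => n; rewrite /index_iota subn0.
  rewrite (_ : \sum_(i <- _) _ = \sum_(n <- initial_fset n) P (E n))%E//.
  by rewrite big_initial_fset; apply: eq_bigr => i _; exact: PF.
move=> omega /= H k _; apply: contrapT => nk; apply: H.
exists (initial_fset k) => n; rewrite in_initial_fset -leqNgt => kn En.
by apply: nk; exists (choice.pickle n) => //; rewrite /F pickleK_inv.
Qed.

Context {d : nat}.
Variables (chi : wavelet_index d -> {RV P >-> R}) (law : probability R R).

Lemma ae_coefficient_growth (gamma : R) :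
  (forall n A, measurable A -> distribution P (chi n) A = law A) ->
  0 < gamma -> exponential_decay law gamma ->
  {ae P, forall omega, exists2 B, 0 < B &
    forall n, `|chi n omega| <= B * (1 + (val n).1.2%:R) `^ gamma^-1}.
Proof.
move=> chi_law gamma0 [C0 [b [C0_gt0 b0 tail]]].
(* Chosen so that the threshold [x j] satisfies [b * x j ^ gamma = (d + 1) (j + 1) ln 2], which
   turns the tail bound into a power of 2. *)
pose a := (d.+1%:R * ln 2 / b) `^ gamma^-1.
have ln20 : (0 : R) < ln 2 by rewrite ln_gt0// ltr1n.
have a0 : 0 < a by rewrite powR_gt0// divr_gt0// mulr_gt0.
pose x (j : nat) := a * (1 + j%:R) `^ gamma^-1.
have x0 j : 0 < x j by rewrite mulr_gt0// powR_gt0// ltr_wpDr.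
have xE j : C0 * expR (- b * x j `^ gamma) = C0 * 2 ^- (d.+1 * j.+1).
  congr (_ * _); rewrite -expR_ln2M -expRN; congr expR.
  rewrite /x powRM ?powR_ge0// -!powRrM mulVf ?gt_eqF// !powRr1 ?addr_ge0//; last first.
    by rewrite divr_ge0 ?mulr_ge0// ltW.
  by rewrite natrM -(natr1 j) addrC; field; rewrite gt_eqF.
pose E n : set Omega := [set omega | x (val n).1.2 <= `|chi n omega|].
have mA y : measurable [set t : R | y <= `|t|].
  rewrite [X in measurable X](_ : _ = (fun t : R => `|t|) @^-1` `[y, +oo[%classic); last first.
    by apply/seteqP; split => t /=; rewrite in_itv/= andbT.
  by rewrite -[X in measurable X]setTI; exact: normr_measurable.
have mE n : measurable (E n).
  rewrite [X in measurable X](_ : _ = chi n @^-1` [set t : R | x (val n).1.2 <= `|t|])//.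
  by rewrite -[X in measurable X]setTI; exact: measurable_funP.
have PE n : (P (E n) <= (C0 * 2 ^- (d.+1 * (val n).1.2.+1))%:E)%E.
  by have := tail _ (x0 (val n).1.2); rewrite xE -(chi_law n).
(* The index type again, now with the countable structure that the enumeration requires. *)
pose I : countType := {n : 'I_(2 ^ d).-1 * nat * 'rV[int]_d |
  [forall s, 0 <= n.2 ord0 s < 2 ^+ n.1.2]}.
have := @ae_finitely_many I E ((2 ^ d).-1%:R * (C0 * 2)) mE.
case=> [J|N [mN N0 HN]].
  apply: (@le_trans _ _ (\sum_(n <- J) (C0 * 2 ^- (d.+1 * (val n).1.2.+1))%:E)%E).
    by apply: lee_sum => n _; exact: PE.
  rewrite sumEFin lee_fin.
  (* With [w] constantly 1, [level_family_le] counts the indices of each level. *)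
  have [|||m] := @level_family_le R d (fun n => C0 * 2 ^- (d.+1 * (val n).1.2.+1))
    (fun _ _ _ => 1) (fun j => C0 * 2 ^- (d.+1 * j.+1)) (fun j => ((2 ^ j) ^ d)%:R) _ _ _ J.
  - by move=> n; rewrite ger0_norm// mulr_ge0 ?invr_ge0 ?exprn_ge0// ltW.
  - by move=> j; rewrite mulr_ge0 ?invr_ge0 ?exprn_ge0// ltW.
  - move=> i j s us sj; rewrite normr1 big_const_seq count_predT iter_addr_0.
    by rewrite ler_nat size_level_range.
  move=> h; apply: (@le_trans _ _ _ _ _ (le_trans _ h)).
    apply: ler_sum => n _; rewrite mulr1; exact: ler_norm.
  (* The count [2 ^ (j d)] times [2 ^ (- (d + 1) (j + 1))] is at most [2 ^ (- j)], and these sum to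
     at most 2. *)
  rewrite ler_wpM2l//; apply: (@le_trans _ _ (\sum_(j < m) C0 * 2^-1 ^+ j)).
    apply: ler_sum => j _; rewrite -mulrA ler_pM2l// natrX natrX -exprM.
    rewrite mulrC ler_pdivrMr ?exprn_gt0// exprVn ler_pdivlMl ?exprn_gt0//.
    rewrite -exprD ler_eXn2l ?ltr1n//.
    by rewrite -mulnS mulnC leq_mul.
  rewrite -mulr_sumr ler_pM2l//.
  have := @sum_geometric_le R 2^-1 m.
  have -> : (1 - 2^-1)^-1 = 2 :> R by field.
  by apply; rewrite invr_ge0 ler0n invf_lt1// ltr1n.
exists N; split=> //; apply: subset_trans HN => omega /= + H; apply.
have [J HJ] := H; pose S := \sum_(n <- J) `|chi n omega|.
have S0 : 0 <= S by exact: sumr_ge0.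
(* [a] serves the indices outside [J]; the finitely many exceptions are covered by [S], because the
   growth factor is at least 1. *)
exists (a + S); first by rewrite ltr_wpDr.
move=> n; have y1 : 1 <= (1 + (val n).1.2%:R) `^ gamma^-1.
  apply: (@le_trans _ _ (1 `^ gamma^-1)); first by rewrite powR1.
  by apply: ge0_ler_powR; rewrite ?nnegrE ?addr_ge0 ?invr_ge0 ?(ltW gamma0)// lerDl.
have [nJ|nJ] := boolP (n \in J).
  apply: (@le_trans _ _ (a + S)); last by rewrite ler_peMr// addr_ge0// ltW.
  apply: (@le_trans _ _ S); last by rewrite lerDr ltW.
  by rewrite /S (bigD1_seq n) ?fset_uniq//= lerDl sumr_ge0.
have /negP := HJ n nJ; rewrite -ltNge => /ltW/le_trans; apply.
by rewrite ler_wpM2r ?powR_ge0// lerDl.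
Qed.

End borel_cantelli.

(** * Regularity of the randomization *)

Section main.
Context {R : realType} {d : nat}.
Implicit Types (x y : 'rV[R]_d) (f : 'rV[R]_d -> R) (n : wavelet_index d).

Lemma periodized_waveletE (Psi : 'I_(2 ^ d).-1 -> 'rV[R]_d -> R) n x :
  periodized_wavelet Psi n x =
  periodized (Psi (val n).1.1) (val n).1.2 (val n).2 x.
Proof. by case: n => [[[i j] k] ?]. Qed.

Lemma holder_torus_le (alpha : R) f : 0 < alpha -> holder_torus alpha f ->
  exists2 C, 0 < C & forall x y, `|f x - f y| <= C * `|x - y| `^ alpha.
Proof.
move=> a0 [_ _ [C C0 fC]]; exists C => // x y; apply: le_trans (fC x y) _.
rewrite ler_wpM2l ?(ltW C0)//; apply: ge0_ler_powR; rewrite ?nnegrE ?(ltW a0)//.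
  by have [l [-> _]] := torus_dist_min x y.
exact: torus_dist_le.
Qed.

Lemma measurable_holder (alpha C : R) f : 0 < alpha -> 0 < C ->
  (forall x y, `|f x - f y| <= C * `|x - y| `^ alpha) -> measurable_fun setT f.
Proof.
move=> a0 C0 fC; apply: measurable_continuous_rV => x.
have F : Filter (nbhs x) by exact: nbhs_filter.
apply/(@cvgrPdist_le _ _ _ (nbhs x) F) => e e0.
have eC : 0 < (e / C) `^ alpha^-1 by rewrite powR_gt0// divr_gt0.
near=> y; apply: le_trans (fC _ _) _.
rewrite -ler_pdivlMl// mulrC.
have -> : e / C = ((e / C) `^ alpha^-1) `^ alpha.
  by rewrite -powRrM mulVf ?gt_eqF// powRr1// ltW// divr_gt0.
have : `|x - y| <= (e / C) `^ alpha^-1 by near: y; exact: cvgr_dist_le.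
by apply: ge0_ler_powR; rewrite ?nnegrE ?(ltW a0) ?(ltW eC).
Unshelve. all: by end_near. Qed.

Lemma wavelet_coef_le (phi : 'rV[R]_d -> R) Psi (alpha : R) f :
  orthonormal_wavelet_basis phi Psi 1 -> 0 < alpha <= 1 -> holder_torus alpha f ->
  exists2 C, 0 < C & forall n,
    `|wavelet_coef Psi f n| <= C * (2 ^- (val n).1.2) `^ alpha.
Proof.
move=> W /andP[a0 a1] fH; have [C PC] := wavelet_localized W.
have [Cf Cf0 fC] := holder_torus_le a0 fH.
have [fper [M fM] _] := fH.
(* [PC] yields positivity of [C] only through some index [i]; [|C| + 1] is positive outright. *)
have C'0 : 0 < Cf * (`|C| + 1) * 16 ^+ d.
  by rewrite !mulr_gt0 ?exprn_gt0// ltr_wpDl.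
exists (Cf * (`|C| + 1) * 16 ^+ d) => // n.
have PC' : localized (`|C| + 1) (Psi (val n).1.1).
  by apply: localized_mono (PC _); rewrite (le_trans (ler_norm _))// lerDl.
rewrite /wavelet_coef; under eq_Rintegral do rewrite periodized_waveletE.
apply: (periodized_coef_le PC' (M := M)) => //.
- exact: measurable_holder fC.
- by move=> x l; apply: fper; exists (- l); rewrite intvN.
- exact: ltW.
- by rewrite (ltW a0).
- exact: wavelet_integral0 W.
Qed.

End main.

Theorem proposition5p3 (R : realType) (d : nat) (d_gt0 : (0 < d)%N)
    (phi : 'rV[R]_d -> R) (Psi : 'I_(2 ^ d).-1 -> 'rV[R]_d -> R)
    (wavelets : orthonormal_wavelet_basis phi Psi 1)
    (dO : measure_display) (Omega : measurableType dO)
    (P : probability Omega R)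
    (chi : wavelet_index d -> {RV P >-> R}) (law : probability R R)
    (chi_iid : iid chi law)
    (gamma : R) (gamma_gt0 : 0 < gamma) (gamma_le2 : gamma <= 2)
    (law_decay : exponential_decay law gamma)
    (alpha : R) (alpha_gt0 : 0 < alpha) (alpha_lt1 : alpha < 1)
    (f : 'rV[R]_d -> R) (f_holder : holder_torus alpha f) :
  {ae P, forall omega,
    let X_f := wavelet_randomization Psi f (fun n => chi n omega) in
    (forall x : 'rV[R]_d, summability.summable
       (randomization_term Psi f (fun n => chi n omega) x)) /\
    exists2 C : R, 0 < C &
      forall x y : 'rV[R]_d, ~ torus_eq x y ->
        `|X_f x - X_f y| <=
        C * torus_dist x y `^ alpha * `|ln (torus_dist x y)| `^ gamma^-1}.
Proof.
have [_ chi_law] := chi_iid.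
have p0 : 0 <= gamma^-1 by rewrite invr_ge0 ltW.
have a01 : 0 < alpha < 1 by rewrite alpha_gt0.
have [C PC] := wavelet_localized wavelets.
have [Ac Ac0 coefA] : exists2 A, 0 < A & forall n,
    `|wavelet_coef Psi f n| <= A * (2 ^- (val n).1.2) `^ alpha.
  by apply: wavelet_coef_le wavelets _ f_holder; rewrite alpha_gt0 ltW.
have [S HS] := sum_scales_bounded alpha_gt0 p0.
have [T T0 HT] := sum_scales_le a01 p0.
have [N [mN N0 HN]] := ae_coefficient_growth chi_law gamma_gt0 law_decay.
(* The null set comes from the growth of the coefficients alone, so it serves all points; the rest
   is deterministic for a fixed [omega]. *)
exists N; split=> //; apply: subset_trans HN => omega /=; apply: contra_not.
move=> [B B0 chiB].
pose t x n := randomization_term Psi f (fun n => chi n omega) x n.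
pose a n := wavelet_coef Psi f n * chi n omega.
pose A j := Ac * B * ((2 ^- j) `^ alpha * (1 + j%:R) `^ gamma^-1) : R.
have A0 j : 0 <= A j by rewrite !mulr_ge0 ?powR_ge0// ltW.
have aA n : `|a n| <= A (val n).1.2.
  rewrite normrM /A mulrACA; apply: ler_pM => //; exact: coefA.
have PC' i : localized (`|C| + 1) (Psi i).
  by apply: localized_mono (PC i); rewrite (le_trans (ler_norm _))// lerDl.
have C1 : 0 < `|C| + 1 by rewrite ltr_wpDl.
pose D : R := (2 ^ d).-1%:R.
have tE x n : t x n = a n * periodized (Psi (val n).1.1) (val n).1.2 (val n).2 x.
  by rewrite /t /randomization_term periodized_waveletE.
(* Absolute convergence with a bound uniform in [x]: it gives summability and allows the difference
   to be taken termwise. *)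
have tM x : abs_sums_le (t x) (D * (Ac * B * ((`|C| + 1) * 16 ^+ d) * S)).
  move=> J; under eq_bigr do rewrite tE.
  have [|m] := level_family_le (w := fun i j k => periodized (Psi i) j k x)
    (V := fun=> (`|C| + 1) * 16 ^+ d) aA A0 _ J.
    by move=> i j s us sj; exact: periodized_level_sum_le.
  move=> /le_trans; apply; rewrite ler_wpM2l//.
  rewrite -mulr_suml /A -mulr_sumr mulrAC ler_wpM2l// !mulr_ge0 ?exprn_ge0// ltW//.
split; first by move=> x; exact: summable_abs_sums (tM x).
have Xper x l : wavelet_randomization Psi f (fun n => chi n omega) (x + intv l) =
    wavelet_randomization Psi f (fun n => chi n omega) x.
  congr summability.sum; apply/funext => n.
  by rewrite -/(t _ n) -/(t _ n) !tE (periodized_periodic (PC' _)).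
(* Adding 1 makes the constant positive without examining its factors. *)
exists (D * (Ac * B * (2 * (`|C| + 1) * 16 ^+ d)) * T + 1).
  rewrite ltr_wpDl// !mulr_ge0 ?exprn_ge0// ltW//.
move=> x y xy; have [l [dE d2]] := torus_dist_min x y.
have d0 : 0 < torus_dist x y.
  rewrite dE normr_gt0 subr_eq0 subr_eq; apply: contra_notN xy => /eqP ->.
  by exists l; rewrite addrC.
(* By periodicity [y] may be replaced by the representative nearest to [x], for which the torus
   distance is the norm distance and at most 1/2, as [sum_scales_le] requires. *)
rewrite -(Xper y l); set y' := y + intv l.
have dE' : torus_dist x y = `|x - y'| by rewrite dE /y' opprD addrA.
rewrite /wavelet_randomization -(sum_unconditionalB (tM x) (tM y')).
apply: normr_sum_le => J.
have -> : \sum_(n <- J) `|t x n - t y' n| = \sum_(n <- J)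
    `|a n * (periodized (Psi (val n).1.1) (val n).1.2 (val n).2 x -
             periodized (Psi (val n).1.1) (val n).1.2 (val n).2 y')|.
  by apply: eq_bigr => n _; rewrite !tE mulrBr.
have [|m] := level_family_le
  (w := fun i j k => periodized (Psi i) j k x - periodized (Psi i) j k y')
  (V := fun j => 2 * (`|C| + 1) * 16 ^+ d * Num.min 1 (2 ^+ j * `|x - y'|)) aA A0 _ J.
  by move=> i j s us sj; exact: periodizedB_level_sum_le.
move=> /le_trans; apply.
have dd : 0 < torus_dist x y <= 2^-1 by rewrite d0 dE.
have := HT _ m dd; set Q := \sum_(j < m) _ => HQ.
have -> : \sum_(j < m) A j * (2 * (`|C| + 1) * 16 ^+ d * Num.min 1 (2 ^+ j * `|x - y'|)) =
    Ac * B * (2 * (`|C| + 1) * 16 ^+ d) * Q.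
  by rewrite mulr_sumr -dE'; apply: eq_bigr => j _; rewrite /A; ring.
set G := Ac * B * _; have G0 : 0 <= G by rewrite !mulr_ge0 ?exprn_ge0// ltW.
rewrite mulrA; apply: (@le_trans _ _ (D * G * (T * torus_dist x y `^ alpha *
    `|ln (torus_dist x y)| `^ gamma^-1))); first by rewrite ler_wpM2l// mulr_ge0.
by rewrite !mulrA ler_wpM2r ?powR_ge0// ler_wpM2r ?powR_ge0// lerDl.
Qed.
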